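(* Let $n\in\mathbb{N}$, $0\le\rho\le1$, $\epsilon>0$, let $C$ be a constant and $\delta=\rho^C$. There is an algorithm solving $(n,\epsilon,\rho,\delta)$-replicable closeness testing with worst-case sample complexity $$O\left(\frac{n^{2/3}}{\epsilon^{4/3}\rho^{2/3}}+\frac{\sqrt{n}}{\epsilon^2\rho}+\frac{1}{\epsilon^2\rho^2}\right).$$
   Context: An algorithm $\mathcal{A}$ with sample access to distributions $p,q$ on $[n]$ solves $(n,\epsilon,\rho,\delta)$-replicable closeness testing if: it accepts with probability at least $1-\delta$ when $p=q$; it rejects with probability at least $1-\delta$ when $\|p-q\|_1\ge\epsilon$; and for every pair $(p',q')$ of distributions on $[n]$, $\Pr_{X,X',r}[\mathcal{A}(X;r)=\mathcal{A}(X';r)]\ge1-\rho$, where $X,X'$ are independent sample sets from the product distribution $p'\times q'$ and $r$ is the shared internal randomness.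
   Formalization: The case ρ = 0 is excluded (0 < ρ ≤ 1 is assumed), because the stated sample bound divides by ρ and is undefined there. *)

(* Defs.v *)
From HB Require Import structures.
From mathcomp Require Import all_boot all_order all_algebra.
From mathcomp Require Import all_classical all_reals all_analysis.

Set Implicit Arguments.
Unset Strict Implicit.
Unset Printing Implicit Defensive.
Import Order.TTheory GRing.Theory Num.Theory.
Local Open Scope ring_scope.
Local Open Scope classical_set_scope.

(** Replicable closeness testing, over MathComp-Analysis reals. *)

(* [n] = {1, ..., n} is represented by 'I_n. *)
Definition is_distribution (R : realType) (n : nat) (p : 'I_n -> R) : Prop :=
  (forall i, 0 <= p i) /\ \sum_(i < n) p i = 1.

Definition l1_distance (R : realType) (n : nat) (p q : 'I_n -> R) : R :=
  \sum_(i < n) `|p i - q i|.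

(* m draws from p x q, i.e., m samples from p paired with m samples from q. *)
Definition samples (n m : nat) := {ffun 'I_m -> 'I_n * 'I_n}.

Definition sample_prob (R : realType) (n m : nat) (p q : 'I_n -> R)
    (X : samples n m) : R :=
  \prod_(i < m) (p (X i).1 * q (X i).2).

(* The internal randomness r lives in an arbitrary probability space, which is
   part of the algorithm and depends neither on the samples nor on p and q.
   The output true means "accept". An algorithm drawing adaptively at most m
   samples from each distribution is one that ignores part of its input. *)
Record tester (R : realType) (n m : nat) := Tester {
  rand_display : measure_display ;
  rand_space : measurableType rand_display ;
  rand_prob : probability rand_space R ;
  run : samples n m -> rand_space -> bool ;
  measurable_run : forall X : samples n m, measurable_fun setT (run X)
}.

(* Pr_{X,r}[A(X;r) = b]. As there are finitely many sample sets, the product of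
   their law with that of r is written as a weighted sum; likewise below. *)
Definition output_prob (R : realType) (n m : nat) (A : tester R n m)
    (p q : 'I_n -> R) (b : bool) : R :=
  \sum_(X : samples n m)
    sample_prob p q X * fine (rand_prob A [set r | run X r = b]).

(* Pr_{X,X',r}[A(X;r) = A(X';r)], with X, X' independent and r shared. *)
Definition agreement_prob (R : realType) (n m : nat) (A : tester R n m)
    (p q : 'I_n -> R) : R :=
  \sum_(X : samples n m) \sum_(X' : samples n m)
    sample_prob p q X * sample_prob p q X' *
      fine (rand_prob A [set r | run X r = run X' r]).

Definition solves_replicable_closeness (R : realType) (n m : nat)
    (eps rho delta : R) (A : tester R n m) : Prop :=
  [/\ forall p q : 'I_n -> R, is_distribution p -> is_distribution q ->
        p = q -> 1 - delta <= output_prob A p q true,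
      forall p q : 'I_n -> R, is_distribution p -> is_distribution q ->
        eps <= l1_distance p q -> 1 - delta <= output_prob A p q false
    & forall p q : 'I_n -> R, is_distribution p -> is_distribution q ->
        1 - rho <= agreement_prob A p q].

(* Main.v *)
Require Import Defs.
From HB Require Import structures.
From mathcomp Require Import all_boot all_order all_algebra.
From mathcomp Require Import all_classical all_reals all_analysis.
From mathcomp Require Import measurable_realfun.
From mathcomp Require Import ring lra zify.

Set Implicit Arguments.
Unset Strict Implicit.
Unset Printing Implicit Defensive.
Import Order.TTheory GRing.Theory Num.Theory.
Local Open Scope ring_scope.

(** A replicable tester compares a concentrated statistic with a random
    threshold: if the statistic differs between two runs by [rho] times the
    width of the threshold interval on average, the outputs agree with
    probability [1 - O(rho)].

    Each sample is a pair [x = (x.1, x.2)] drawn from [p * q]; put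
    [v_i(x) = [x.1 = i] - [x.2 = i]], whose mean is [d_i = p_i - q_i], and let
    [h_i <= p_i + q_i] be the probability that bin [i] is hit. A flattening
    sample [F] of size [k] gives the weights [w_i = 1 / (1 + #hits of i in F)],
    and two further samples [A], [B] give the statistic
    [Z = sum_i w_i U_i(A) U_i(B)], where [U_i] sums [v_i]. Given [F], it has mean
    [k^2 g(F)] with [g(F) = sum_i w_i d_i^2] and variance
    [O(k^2 sum_i w_i^2 h_i^2 + k^3 sum_i w_i^2 d_i^2 h_i)]. The moment estimates
    [k h_i E(phi_{r+1}) <= E(phi_r)] for [phi_r(a) = 1/((a+1)...(a+r))] bound the
    expectation of this variance by [O(min(n, k) + k^2 E(g))], and Efron-Stein
    gives [Var(k^2 g) = O(k^2 E(g))]. By Cauchy-Schwarz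
    [g(F) >= |p - q|_1^2 / (n + 2k)] for every [F], while [g = 0] if [p = q].
    Hence [k = O(sample bound)] makes the standard deviation of [Z], in units of
    the gap, at most [rho] times a small constant.

    Chebyshev's inequality alone does not give the error probability [rho^C].
    This is repaired by [L ~ rho^(-1/2)] votes which use the same flattening
    sample, so that they estimate the same [g(F)], with only [O(L rho k)] fresh
    samples each: they have to be accurate up to a constant only. When the
    majority says that [g(F)] is small (large), the statistic is replaced by 0
    (by 5), where the gap is scaled to 5 and the threshold is uniform on [2, 3];
    up to an event of probability [2^(-L+1)], its value clipped to [2, 3] is then
    that of the scaled [g(F)]. That the conditional variance given [F] is under
    control with probability [1 - 2^-L] follows by cutting [F] into [L] pieces: it
    suffices that one of them is good. *)

(** * Expectation over an i.i.d. sample *)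

Record law (R : realFieldType) (T : finType) := Law {
  weight :> T -> R ;
  weight_ge0 : forall x, 0 <= weight x ;
  weight_sum : \sum_x weight x = 1
}.

Section Expectation.
Context (R : realFieldType) (T : finType) (P : law R T).
Implicit Types (f g : T -> R) (F G : seq T -> R).

Definition mean f : R := \sum_x P x * f x.

Lemma eq_mean f g : f =1 g -> mean f = mean g.
Proof. by move=> fg; apply: eq_bigr => x _; rewrite fg. Qed.

Lemma meanD f g : mean (fun x => f x + g x) = mean f + mean g.
Proof. by rewrite /mean -big_split; apply: eq_bigr => x _; rewrite mulrDr. Qed.

Lemma meanZ c f : mean (fun x => c * f x) = c * mean f.
Proof. by rewrite /mean mulr_sumr; apply: eq_bigr => x _; rewrite mulrCA. Qed.

Lemma mean_cst c : mean (fun=> c) = c.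
Proof. by rewrite /mean -mulr_suml weight_sum mul1r. Qed.

Lemma meanB f g : mean (fun x => f x - g x) = mean f - mean g.
Proof.
rewrite meanD; congr (_ + _); rewrite -mulN1r -meanZ.
by apply: eq_mean => x; rewrite mulN1r.
Qed.

Lemma ler_mean f g : (forall x, f x <= g x) -> mean f <= mean g.
Proof. by move=> fg; apply: ler_sum => x _; rewrite ler_wpM2l ?weight_ge0. Qed.

Lemma mean_ge0 f : (forall x, 0 <= f x) -> 0 <= mean f.
Proof. by move=> f0; rewrite -(mean_cst 0); apply: ler_mean. Qed.

Lemma mean_sum (I : Type) (r : seq I) (Q : pred I) (f : I -> T -> R) :
  mean (fun x => \sum_(i <- r | Q i) f i x) = \sum_(i <- r | Q i) mean (f i).
Proof.
rewrite /mean exchange_big /=; apply: eq_bigr => x _.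
by rewrite mulr_sumr.
Qed.

Lemma sqr_mean f : mean f ^+ 2 <= mean (fun x => f x ^+ 2).
Proof.
have: 0 <= mean (fun x => (f x - mean f) ^+ 2) by apply: mean_ge0 => x; exact: sqr_ge0.
rewrite (@eq_mean _ (fun x => f x ^+ 2 - 2 * mean f * f x + mean f ^+ 2)); last first.
  by move=> x; ring.
rewrite meanD meanB meanZ mean_cst; lra.
Qed.

(** Iterated means over lists make conditioning on an initial segment ([expect_cat]) a plain
    induction; [expect_ffun] relates them to sums over sample functions. *)
Fixpoint expect (N : nat) F : R :=
  if N is N'.+1 then mean (fun x => expect N' (fun s => F (x :: s))) else F [::].

Lemma eq_expect N F G :
  (forall s, size s = N -> F s = G s) -> expect N F = expect N G.
Proof.
elim: N F G => [|N IH] F G FG /=; first exact: FG.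
by apply: eq_mean => x; apply: IH => s sN; apply: FG; rewrite /= sN.
Qed.

Lemma expectD N F G : expect N (fun s => F s + G s) = expect N F + expect N G.
Proof.
elim: N F G => [|N IH] F G //=; rewrite -meanD.
by apply: eq_mean => x; rewrite IH.
Qed.

Lemma expectZ N c F : expect N (fun s => c * F s) = c * expect N F.
Proof.
elim: N F => [|N IH] F //=; rewrite -meanZ.
by apply: eq_mean => x; rewrite IH.
Qed.

Lemma expect_cst N c : expect N (fun=> c) = c.
Proof. by elim: N => [|N IH] //=; rewrite IH mean_cst. Qed.

Lemma expectB N F G : expect N (fun s => F s - G s) = expect N F - expect N G.
Proof.
rewrite expectD; congr (_ + _); rewrite -mulN1r -expectZ.
by apply: eq_expect => x _; rewrite mulN1r.
Qed.

Lemma ler_expect N F G :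
  (forall s, size s = N -> F s <= G s) -> expect N F <= expect N G.
Proof.
elim: N F G => [|N IH] F G FG /=; first exact: FG.
by apply: ler_mean => x; apply: IH => s sN; apply: FG; rewrite /= sN.
Qed.

Lemma expect_ge0 N F : (forall s, size s = N -> 0 <= F s) -> 0 <= expect N F.
Proof. by move=> F0; rewrite -(expect_cst N 0); apply: ler_expect. Qed.

Lemma mean_exchange (f : T -> T -> R) :
  mean (fun x => mean (f x)) = mean (fun y => mean (f ^~ y)).
Proof.
rewrite /mean; under eq_bigr do rewrite mulr_sumr.
rewrite exchange_big; apply: eq_bigr => x _; rewrite mulr_sumr.
by apply: eq_bigr => y _; rewrite mulrCA.
Qed.

Lemma expect_sum N (I : Type) (r : seq I) (Q : pred I) (F : I -> seq T -> R) :
  expect N (fun s => \sum_(i <- r | Q i) F i s) =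
  \sum_(i <- r | Q i) expect N (F i).
Proof.
elim: N F => [|N IH] F //=; rewrite -mean_sum.
by apply: eq_mean => x; rewrite IH.
Qed.

Lemma expect_cat M N F :
  expect (M + N) F = expect M (fun s => expect N (fun t => F (s ++ t))).
Proof.
elim: M F => [|M IH] F //=.
by apply: eq_mean => x; rewrite IH.
Qed.

Lemma sqr_expect N F : expect N F ^+ 2 <= expect N (fun s => F s ^+ 2).
Proof.
elim: N F => [|N IH] F //=.
by apply: le_trans (sqr_mean _) _; apply: ler_mean => x; apply: IH.
Qed.

Lemma expect_variance N F :
  expect N (fun s => (F s - expect N F) ^+ 2) =
  expect N (fun s => F s ^+ 2) - expect N F ^+ 2.
Proof.
rewrite (@eq_expect _ _ (fun s => F s ^+ 2 - (2 * expect N F * F s - expect N F ^+ 2))).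
  by rewrite expectB expectB expectZ expect_cst; ring.
by move=> s _; ring.
Qed.

(* Efron-Stein for a symmetric function of an i.i.d. sample; permutation
   invariance lets every sample be moved to the front. *)
Lemma efron_stein N F :
  (forall s t, perm_eq s t -> F s = F t) ->
  expect N.+1 (fun s => (F s - expect N.+1 F) ^+ 2) <=
  N.+1%:R * mean (fun x => expect N (fun s => (F (x :: s) - F s) ^+ 2)).
Proof.
rewrite expect_variance.
elim: N F => [|N IH] F symF.
  rewrite /= mul1r.
  (* For one sample: the variance is at most the mean square deviation from any constant, here [F
     [::]]. *)
  have -> : mean (fun x => (F [:: x] - F [::]) ^+ 2) =
    mean (fun x => F [:: x] ^+ 2) - (2 * F [::] * mean (fun x => F [:: x]) - F [::] ^+ 2).
    rewrite -meanZ -[X in _ - (_ - X)](mean_cst (F [::] ^+ 2)) -!meanB.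
    by apply: eq_mean => x; ring.
  by have := sqr_ge0 (mean (fun x => F [:: x]) - F [::]); lra.
(* The variance is split by conditioning on the first sample: [H1] bounds the mean conditional
   variance by induction, [H2] the variance of the conditional mean by Jensen. *)
pose D := mean (fun x => expect N.+1 (fun s => (F (x :: s) - F s) ^+ 2)).
rewrite -/D.
have H1 : mean (fun x => expect N.+1 (fun s => F (x :: s) ^+ 2)
    - expect N.+1 (fun s => F (x :: s)) ^+ 2) <= N.+1%:R * D.
  have -> : N.+1%:R * D = mean (fun x => N.+1%:R * mean (fun y =>
     expect N (fun s => (F (x :: y :: s) - F (x :: s)) ^+ 2))).
    rewrite meanZ; congr (_ * _); rewrite /D /=.
    rewrite mean_exchange; apply: eq_mean => x; apply: eq_mean => y.
    apply: eq_expect => s _; rewrite (symF [:: y, x & s] [:: x, y & s]) //.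
    exact/permPl/(perm_catCA [:: y] [:: x] s).
  apply: ler_mean => x; apply: (IH (fun s => F (x :: s))) => s t st.
  by apply: symF; rewrite perm_cons.
have H2 : mean (fun x => expect N.+1 (fun s => F (x :: s)) ^+ 2)
   - mean (fun x => expect N.+1 (fun s => F (x :: s))) ^+ 2 <= D.
  set e := expect N.+1 F.
  have : mean (fun x => (expect N.+1 (fun s => F (x :: s)) - e) ^+ 2) <= D.
    apply: ler_mean => x; rewrite -expectB; exact: sqr_expect.
  rewrite (@eq_mean _ (fun x => expect N.+1 (fun s => F (x :: s)) ^+ 2
     - (2 * e * expect N.+1 (fun s => F (x :: s)) - e ^+ 2))); last by move=> x; ring.
  rewrite meanB meanB meanZ mean_cst.
  by have := sqr_ge0 (mean (fun x => expect N.+1 (fun s => F (x :: s))) - e); lra.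
rewrite meanB in H1.
rewrite -[expect N.+2 _]/(mean _) -[expect N.+2 _]/(mean _).
rewrite -(natr1 N.+1) mulrDl mul1r; lra.
Qed.

Lemma expect_linear N f :
  expect N (fun s => \sum_(x <- s) f x) = N%:R * mean f.
Proof.
elim: N => [|N IH] /=; first by rewrite big_nil mul0r.
under eq_mean do under eq_expect do rewrite big_cons.
under eq_mean do rewrite expectD expect_cst IH.
by rewrite meanD mean_cst -natr1 mulrDl mul1r addrC.
Qed.

Lemma variance_linear_centered N f : mean f = 0 ->
  expect N (fun s => (\sum_(x <- s) f x) ^+ 2) = N%:R * mean (fun x => f x ^+ 2).
Proof.
move=> f0; elim: N => [|N IH] /=; first by rewrite big_nil mul0r expr0n.
rewrite (@eq_mean _ (fun x => f x ^+ 2 + N%:R * mean (fun x => f x ^+ 2))).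
  by rewrite meanD mean_cst -natr1 mulrDl mul1r addrC.
move=> x; rewrite -IH.
rewrite (@eq_expect _ _ (fun s => f x ^+ 2 +
   (2 * f x * \sum_(y <- s) f y + (\sum_(y <- s) f y) ^+ 2))); last first.
  by move=> s _; rewrite big_cons; ring.
by rewrite expectD expectD expect_cst expectZ expect_linear f0 !mulr0 add0r.
Qed.

Lemma variance_linear N f :
  expect N (fun s => (\sum_(x <- s) f x - N%:R * mean f) ^+ 2) <=
  N%:R * mean (fun x => f x ^+ 2).
Proof.
rewrite (@eq_expect _ _ (fun s => (\sum_(x <- s) (f x - mean f)) ^+ 2)); last first.
  move=> s <-; congr (_ ^+ 2); elim: s => [|x s IH]; first by rewrite !big_nil mul0r subr0.
  by rewrite !big_cons -IH /= -natr1; ring.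
rewrite variance_linear_centered; last by rewrite meanB mean_cst subrr.
rewrite ler_wpM2l //.
rewrite (@eq_mean _ (fun x => f x ^+ 2 - (2 * mean f * f x - mean f ^+ 2))); last first.
  by move=> x; ring.
rewrite meanB meanB meanZ mean_cst.
by have := sqr_ge0 (mean f); lra.
Qed.

Lemma second_moment_linear N f :
  expect N (fun s => (\sum_(x <- s) f x) ^+ 2) <=
  N%:R * mean (fun x => f x ^+ 2) + (N%:R * mean f) ^+ 2.
Proof.
have := variance_linear N f; set e := N%:R * mean f.
have -> : e = expect N (fun s => \sum_(x <- s) f x) by rewrite expect_linear.
by rewrite expect_variance; lra.
Qed.

End Expectation.

(** * Reciprocal rising factorials of a count *)

Section Phi.
Context (R : realFieldType).

(* [phi r a = 1 / ((a + 1) * ... * (a + r))] *)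
Definition phi (r a : nat) : R := a`!%:R / (a + r)`!%:R.

Lemma phi_ge0 r a : 0 <= phi r a.
Proof. by rewrite /phi divr_ge0. Qed.

Lemma phi0 a : phi 0 a = 1.
Proof. by rewrite /phi addn0 divff // pnatr_eq0 -lt0n fact_gt0. Qed.

Lemma phiSl r a : a.+1%:R * phi r.+1 a = phi r a.+1.
Proof. by rewrite /phi factS natrM mulrA addSnnS. Qed.

Lemma phiSr r a : (a + r).+1%:R * phi r.+1 a = phi r a.
Proof.
by rewrite /phi addnS factS natrM invfM mulrCA [X in _ * X]mulrA mulfV ?mul1r
  ?pnatr_eq0.
Qed.

Lemma phi_anti r a : phi r a.+1 <= phi r a.
Proof.
by rewrite -phiSl -(phiSr r a) ler_wpM2r ?phi_ge0 // ler_nat ltnS leq_addr.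
Qed.

Lemma phi1E a : phi 1 a = a.+1%:R^-1.
Proof.
by rewrite /phi addn1 factS natrM invfM mulrCA mulfV ?mulr1 ?pnatr_eq0 -?lt0n
  ?fact_gt0.
Qed.

(** This is the loss of weight of a bin that receives one more hit, the increment needed for
    Efron-Stein. *)
Lemma phi1B a : phi 1 a - phi 1 a.+1 = phi 2 a.
Proof.
have := phiSr 1 a; have := phiSl 1 a; rewrite addn1 => <- <-.
by rewrite -mulrBl -[a.+2%:R]natr1 addrC addKr mul1r.
Qed.

Lemma sqr_phi1 a : phi 1 a ^+ 2 <= 2 * phi 2 a.
Proof.
rewrite expr2 -{2}(phiSr 1 a) mulrA ler_wpM2r ?phi_ge0 //.
rewrite phi1E mulrC ler_pdivrMr ?ltr0n // -natrM ler_nat; lia.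
Qed.

(** The quotient of the two sides without the constant is (a+3)(a+4)/((a+1)(a+2)), largest at a = 0,
    where it is 6. *)
Lemma sqr_phi2 a : phi 2 a ^+ 2 <= 6 * phi 4 a.
Proof.
have e3 := phiSr 2 a; have e4 := phiSr 3 a.
have -> : phi 2 a ^+ 2 = phi 2 a * ((a + 2).+1%:R * (a + 3).+1%:R) * phi 4 a.
  by rewrite expr2 -{2}e3 -e4 !mulrA.
rewrite ler_wpM2r ?phi_ge0 // -natrM.
have -> : phi 2 a = (a.+1 * a.+2)%:R^-1.
  apply: (@mulfI _ (a.+1 * a.+2)%:R); first by rewrite pnatr_eq0.
  rewrite mulfV ?pnatr_eq0 // natrM -mulrA.
  by have := phiSr 1 a; rewrite addn1 phi1E => ->; rewrite mulfV // pnatr_eq0.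
rewrite mulrC ler_pdivrMr ?ltr0n // -natrM ler_nat; nia.
Qed.

End Phi.

(** * Moment estimates for the number of hits *)

Section Count.
Context (R : realFieldType) (T : finType) (P : law R T) (c : pred T).

Local Notation q := (mean P (fun x => (c x)%:R)).
Local Notation E N f := (expect P N (fun s => f (count c s))).

(* Each of the [N.+1] samples contributes equally. *)
Lemma expect_count N (f : nat -> R) :
  E N.+1 (fun a => a%:R * f a) = N.+1%:R * q * E N (fun a => f a.+1).
Proof.
elim: N f => [|N IH] f.
  rewrite /= mul1r mulrC -meanZ; apply: eq_mean => x.
  by case: (c x); rewrite /= ?mul0r ?mulr0 // mul1r mulr1.
rewrite -[LHS]/(mean P (fun x => E N.+1 (fun a => (c x + a)%:R * f (c x + a)%N))).
rewrite (@eq_mean _ _ _ _ (fun x => E N.+1 (fun a => f a.+1) * (c x)%:R +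
   N.+1%:R * q * E N (fun a => f (c x + a).+1))).
  rewrite meanD !meanZ -[mean P (fun x => E N (fun a => f (c x + a).+1))]/(E N.+1 (fun a => f a.+1)).
  by rewrite -[in RHS](natr1 N.+1); ring.
move=> x; under [X in _ + _ * X]eq_expect do rewrite -addnS.
rewrite -(IH (fun a => f (c x + a)%N)) mulrC -expectZ -expectD.
apply: (@eq_expect _ _ _ N.+1) => s _ /=.
by case: (c x); rewrite /= ?add0n ?mul0r ?add0r // mul1r add1n -natr1; ring.
Qed.

Lemma expect_phi_shift r N :
  N.+1%:R * q * E N (@phi R r.+1) <= E N.+1 (@phi R r).
Proof.
(* The predecessor of 0 does no harm: that term carries the factor [a = 0]. *)
rewrite -(expect_count N (fun a => @phi R r.+1 a.-1)); apply: ler_expect.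
by move=> s _; case: (count c s) => [|a]; rewrite ?mul0r ?phi_ge0 //= phiSl.
Qed.

Lemma expect_phi_anti r N : E N.+1 (@phi R r) <= E N (@phi R r).
Proof.
rewrite -[leRHS](mean_cst P); apply: ler_mean => x; apply: ler_expect => s _ /=.
by case: (c x) => //=; rewrite add1n phi_anti.
Qed.

Lemma expect_phi r N :
  N.+1%:R * q * E N.+1 (@phi R r.+1) <= E N.+1 (@phi R r).
Proof.
apply: le_trans (expect_phi_shift r N); rewrite ler_wpM2l ?expect_phi_anti //.
by rewrite mulr_ge0 // mean_ge0.
Qed.

End Count.

(** * The flattened closeness statistic *)

Section Statistic.
Context (R : realFieldType) (n : nat) (P : law R ('I_n * 'I_n)%type).
Local Notation T := ('I_n * 'I_n)%type.
Implicit Types (x : T) (s : seq T) (i : 'I_n).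

Definition hit i x : bool := (x.1 == i) || (x.2 == i).
Definition diff i x : R := (x.1 == i)%:R - (x.2 == i)%:R.
Definition hit_prob i : R := mean P (fun x => (hit i x)%:R).
Definition bias i : R := mean P (diff i).

(* Flattening: bin [i] is split into [1 + count (hit i) s] parts. *)
Definition split_weight s i : R := phi R 1 (count (hit i) s).
Definition diff_count s i : R := \sum_(x <- s) diff i x.
(** Two independent samples make the product of the counts unbiased for the square of the bias, with
    no diagonal term to subtract. *)
Definition zstat (w : 'I_n -> R) (s t : seq T) : R :=
  \sum_i w i * diff_count s i * diff_count t i.
Definition zmean (w : 'I_n -> R) : R := \sum_i w i * bias i ^+ 2.
(** [zvar] measures pure sampling noise, and [zcross] noise multiplied by bias; together they bound
    the variance of [zstat]. *)
Definition zvar (w : 'I_n -> R) : R := \sum_i (w i * hit_prob i) ^+ 2.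
Definition zcross (w : 'I_n -> R) : R := \sum_i w i ^+ 2 * bias i ^+ 2 * hit_prob i.

Lemma sum_hit x (c : 'I_n -> R) :
  \sum_i (hit i x)%:R * c i = c x.1 + (x.1 != x.2)%:R * c x.2.
Proof.
rewrite (bigD1 x.1) //= /hit eqxx mul1r; congr (_ + _).
case: (eqVneq x.1 x.2) => [e|ne] /=.
  rewrite mul0r big1 // => i ix; rewrite -e eq_sym (negbTE ix) orbb mul0r.
  by [].
rewrite (bigD1 x.2) ?(eq_sym x.2) //= eqxx orbT mul1r big1 ?addr0 // ?mul1r //.
by move=> i /andP[i1 i2]; rewrite eq_sym (negbTE i1) eq_sym (negbTE i2) mul0r.
Qed.

Lemma sum_diff x (c : 'I_n -> R) : \sum_i c i * diff i x = c x.1 - c x.2.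
Proof.
have pick j : \sum_i c i * (j == i)%:R = c j.
  rewrite (bigD1 j) //= eqxx mulr1 big1 ?addr0 // => i ij.
  by rewrite eq_sym (negbTE ij) mulr0.
by under eq_bigr do rewrite mulrBr; rewrite sumrB !pick.
Qed.

(** A sample touches at most two bins, whence the factor 2; if its two entries coincide, they
    cancel. *)
Lemma sqr_sum_diff x (c : 'I_n -> R) :
  (\sum_i c i * diff i x) ^+ 2 <= 2 * \sum_i (hit i x)%:R * c i ^+ 2.
Proof.
rewrite sum_diff sum_hit; case: (eqVneq x.1 x.2) => [->|_] /=.
  by rewrite subrr expr0n mul0r addr0 mulr_ge0 // sqr_ge0.
by have := sqr_ge0 (c x.1 + c x.2); rewrite mul1r; lra.
Qed.

Lemma sqr_sum_hit x (c : 'I_n -> R) :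
  (\sum_i (hit i x)%:R * c i) ^+ 2 <= 2 * \sum_i (hit i x)%:R * c i ^+ 2.
Proof.
rewrite !sum_hit; case: (x.1 != x.2); rewrite ?mul0r ?mul1r ?addr0.
  by have := sqr_ge0 (c x.1 - c x.2); lra.
by have := sqr_ge0 (c x.1); lra.
Qed.

Lemma sum_hit_le2 x : \sum_i (hit i x)%:R <= 2 :> R.
Proof.
have := sum_hit x (fun=> 1); under eq_bigr do rewrite mulr1.
by move=> ->; rewrite mulr1; case: (_ != _) => /=; lra.
Qed.

Lemma sqr_diff_le_hit i x : diff i x ^+ 2 <= (hit i x)%:R.
Proof.
by rewrite /diff /hit; case: (x.1 == i); case: (x.2 == i) => /=;
  rewrite ?subr0 ?sub0r ?subrr ?sqrrN ?expr1n ?expr0n.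
Qed.

Lemma hit_prob_ge0 i : 0 <= hit_prob i.
Proof. exact: mean_ge0. Qed.

Lemma sum_hit_prob : \sum_i hit_prob i <= 2.
Proof.
rewrite /hit_prob -mean_sum -[leRHS](mean_cst P); apply: ler_mean => x.
exact: sum_hit_le2.
Qed.

Lemma normr_bias i : `|bias i| <= hit_prob i.
Proof.
have abs x : diff i x <= (hit i x)%:R /\ - (hit i x)%:R <= diff i x.
  by rewrite /diff /hit; case: (x.1 == i); case: (x.2 == i) => /=; lra.
rewrite ler_norml; apply/andP; split; last by apply: ler_mean => x; case: (abs x).
have: 0 <= mean P (fun x => diff i x + (hit i x)%:R).
  by apply: mean_ge0 => x; case: (abs x); lra.
by rewrite meanD -/(bias i) -/(hit_prob i); lra.
Qed.

Lemma sqr_bias i : bias i ^+ 2 <= hit_prob i ^+ 2.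
Proof.
by rewrite -real_normK ?num_real // lerXn2r ?nnegrE ?hit_prob_ge0 ?normr_bias.
Qed.

Lemma zvar_ge0 w : 0 <= zvar w.
Proof. by apply: sumr_ge0 => i _; exact: sqr_ge0. Qed.

Lemma mean_sqr_sum_diff (c : 'I_n -> R) :
  mean P (fun x => (\sum_i c i * diff i x) ^+ 2) <=
  2 * \sum_i hit_prob i * c i ^+ 2.
Proof.
apply: le_trans (ler_mean P (fun x => sqr_sum_diff x c)) _.
rewrite meanZ mean_sum ler_wpM2l //.
under eq_bigr do (under eq_mean do rewrite mulrC; rewrite meanZ mulrC).
exact: lexx.
Qed.

Lemma sum_diff_count (c : 'I_n -> R) s :
  \sum_(x <- s) \sum_i c i * diff i x = \sum_i c i * diff_count s i.
Proof.
by rewrite exchange_big; apply: eq_bigr => i _; rewrite mulr_sumr.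
Qed.

Lemma mean_sum_diff (c : 'I_n -> R) :
  mean P (fun x => \sum_i c i * diff i x) = \sum_i c i * bias i.
Proof. by rewrite mean_sum; apply: eq_bigr => i _; rewrite meanZ. Qed.

Lemma variance_diff_count m (c : 'I_n -> R) :
  expect P m (fun s => (\sum_i c i * diff_count s i
    - m%:R * \sum_i c i * bias i) ^+ 2) <=
  2 * m%:R * \sum_i hit_prob i * c i ^+ 2.
Proof.
rewrite -mean_sum_diff; under eq_expect do rewrite -sum_diff_count.
apply: le_trans (variance_linear P m _) _.
by rewrite (mulrC 2) -mulrA ler_wpM2l // mean_sqr_sum_diff.
Qed.

Lemma second_moment_diff_count m i :
  expect P m (fun s => diff_count s i ^+ 2) <=
  m%:R * hit_prob i + m%:R ^+ 2 * bias i ^+ 2.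
Proof.
apply: le_trans (second_moment_linear P m (diff i)) _.
rewrite exprMn lerD2r ler_wpM2l // ler_mean // => x; exact: sqr_diff_le_hit.
Qed.

(** Given [s], the mean of the statistic over [t] is [m%:R * b s]. The deviation is split there: the
    first part is linear in the counts of [t], the second in those of [s], so [variance_diff_count]
    applies to each. *)
Lemma zstat_variance m w :
  expect P m (fun s => expect P m (fun t =>
    (zstat w s t - m%:R ^+ 2 * zmean w) ^+ 2)) <=
  4 * m%:R ^+ 2 * zvar w + 8 * m%:R ^+ 3 * zcross w.
Proof.
pose b s := \sum_i (w i * diff_count s i) * bias i.
apply: (@le_trans _ _ (expect P m (fun s =>
   2 * (2 * m%:R * \sum_i hit_prob i * (w i * diff_count s i) ^+ 2) +
   2 * m%:R ^+ 2 * (\sum_i (w i * bias i) * diff_count s i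
       - m%:R * \sum_i (w i * bias i) * bias i) ^+ 2))).
  apply: ler_expect => s _.
  set e := _ - _ * _.
  apply: (@le_trans _ _ (expect P m (fun t =>
     2 * (zstat w s t - m%:R * b s) ^+ 2 + 2 * m%:R ^+ 2 * e ^+ 2))).
    apply: ler_expect => t _.
    have -> : zstat w s t - m%:R ^+ 2 * zmean w =
        (zstat w s t - m%:R * b s) + m%:R * e.
      rewrite /e /b /zmean.
      rewrite (eq_bigr (fun i => w i * bias i * bias i)); last by move=> i _; ring.
      rewrite [\sum_i _ * diff_count _ _ * _](eq_bigr (fun i =>
        w i * bias i * diff_count s i)); last by move=> i _; ring.
      by ring.
    set u := _ - m%:R * b s; have := sqr_ge0 (u - m%:R * e); lra.
  rewrite expectD expectZ expect_cst lerD2r ler_wpM2l //.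
  exact: variance_diff_count.
rewrite expectD !expectZ expect_sum.
have H1 : \sum_i expect P m (fun s => hit_prob i * (w i * diff_count s i) ^+ 2) <=
   m%:R * zvar w + m%:R ^+ 2 * zcross w.
  rewrite /zvar /zcross !mulr_sumr -big_split; apply: ler_sum => i _ /=.
  under eq_expect do rewrite exprMn mulrA.
  rewrite expectZ.
  have -> : m%:R * (w i * hit_prob i) ^+ 2 + m%:R ^+ 2 * (w i ^+ 2 * bias i ^+ 2 * hit_prob i)
   = (hit_prob i * w i ^+ 2) * (m%:R * hit_prob i + m%:R ^+ 2 * bias i ^+ 2) by ring.
  by rewrite ler_wpM2l ?second_moment_diff_count // mulr_ge0 ?sqr_ge0 ?hit_prob_ge0.
have H2 := variance_diff_count m (fun i => w i * bias i).
have eH : \sum_i hit_prob i * (w i * bias i) ^+ 2 = zcross w.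
  by apply: eq_bigr => i _; ring.
rewrite eH in H2.
have m0 : 0 <= m%:R :> R by [].
have H3 : 2 * m%:R * (\sum_i expect P m (fun s => hit_prob i * (w i * diff_count s i) ^+ 2))
  <= 2 * m%:R * (m%:R * zvar w + m%:R ^+ 2 * zcross w) by rewrite ler_wpM2l ?mulr_ge0.
have m2 : 0 <= 2 * m%:R ^+ 2 :> R by rewrite mulr_ge0 ?exprn_ge0.
have H4 := ler_wpM2l m2 H2.
lra.
Qed.

(* Cauchy-Schwarz against the weights [1 / w i]; it holds for every outcome of
   the flattening sample. *)
Lemma zmean_ge s : (0 < n)%N ->
  (\sum_i `|bias i|) ^+ 2 / (n + 2 * size s)%:R <= zmean (split_weight s).
Proof.
move=> n0; set D := \sum_i _; set W : R := (_)%:R.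
have W0 : 0 < W by rewrite ltr0n addn_gt0 n0.
pose r i : R := (count (hit i) s).+1%:R.
have rW : \sum_i r i <= W.
  rewrite /r; under eq_bigr do rewrite -natr1.
  rewrite big_split sumr_const card_ord /= addrC /W natrD lerD2l natrM mulrC.
  elim: s {W W0 r} => [|x s IH] /=; first by rewrite mul0r big1.
  under eq_bigr do rewrite natrD; rewrite big_split /= -natr1 mulrDl mul1r addrC.
  by rewrite lerD // sum_hit_le2.
(* Expanding this square and using that the [r i] sum to at most [W] is Cauchy-Schwarz. *)
have : 0 <= \sum_i (r i)^-1 * (`|bias i| - D / W * r i) ^+ 2.
  by apply: sumr_ge0 => i _; rewrite mulr_ge0 ?invr_ge0 ?sqr_ge0.
rewrite (eq_bigr (fun i => split_weight s i * bias i ^+ 2 -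
   2 * (D / W) * `|bias i| + (D / W) ^+ 2 * r i)); last first.
  move=> i _; rewrite /split_weight phi1E -/(r i) -[bias i ^+ 2]real_normK ?num_real //.
  by field; rewrite -natrM -natrD gt_eqF //= addrC natr1 pnatr_eq0.
rewrite big_split /= sumrB -!mulr_sumr -/(zmean _) -/D.
have := ler_wpM2l (sqr_ge0 (D / W)) rW.
have -> : (D / W) ^+ 2 * W = D ^+ 2 / W by field; rewrite -natrM -natrD gt_eqF.
have -> : 2 * (D / W) * D = 2 * (D ^+ 2 / W) by field; rewrite -natrM -natrD gt_eqF.
lra.
Qed.

(** * Moments of the statistic over the flattening sample *)

Section Flattening.
Variable N : nat.
Local Notation k := (N.+1%:R : R).

Lemma expect_hits r i :
  k * hit_prob i * expect P N.+1 (fun s => phi R r.+1 (count (hit i) s)) <=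
  expect P N.+1 (fun s => phi R r (count (hit i) s)).
Proof. exact: expect_phi. Qed.

Lemma expect_split_weight_sqr i :
  k * hit_prob i * expect P N.+1 (fun s => split_weight s i ^+ 2) <=
  2 * expect P N.+1 (fun s => split_weight s i).
Proof.
have kh : 0 <= k * hit_prob i by rewrite mulr_ge0 ?hit_prob_ge0.
have := ler_wpM2l kh (@ler_expect _ _ P N.+1 _ _ (fun s _ => @sqr_phi1 R (count (hit i) s))).
rewrite expectZ; have := expect_hits 1 i; rewrite /split_weight; lra.
Qed.

Lemma expect_zcross :
  k * expect P N.+1 (zcross \o split_weight) <=
  2 * expect P N.+1 (zmean \o split_weight).
Proof.
rewrite /zcross /zmean /comp !expect_sum !mulr_sumr; apply: ler_sum => i _.
under eq_expect do rewrite -mulrA mulrC.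
rewrite expectZ; under [in leRHS]eq_expect do rewrite mulrC.
rewrite expectZ mulrCA [leLHS]mulrA [leRHS]mulrCA.
have := ler_wpM2l (sqr_ge0 (bias i)) (expect_split_weight_sqr i).
lra.
Qed.

(** By the moment estimates each bin contributes at most 2, and also at most [2 * k * hit_prob i].
    The first bound gives [2 * n]; the second, summed, gives the bound of [expect_zvar_size]. *)
Lemma expect_zvar_card :
  k ^+ 2 * expect P N.+1 (zvar \o split_weight) <= 2 * n%:R.
Proof.
rewrite /zvar /comp !expect_sum !mulr_sumr.
have -> : 2 * n%:R = \sum_(i < n) 2 :> R.
  by rewrite sumr_const card_ord mulr_natr.
apply: ler_sum => i _.
under eq_expect do rewrite exprMn mulrC.
rewrite expectZ.
have kh : 0 <= k * hit_prob i by rewrite mulr_ge0 ?hit_prob_ge0.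
have := ler_wpM2l kh (expect_split_weight_sqr i).
have := expect_hits 0 i; under [leRHS]eq_expect do rewrite phi0.
rewrite expect_cst /split_weight; lra.
Qed.

Lemma expect_zvar_size :
  k ^+ 2 * expect P N.+1 (zvar \o split_weight) <= 4 * k.
Proof.
rewrite /zvar /comp !expect_sum !mulr_sumr.
apply: (@le_trans _ _ (\sum_i 2 * k * hit_prob i)); last first.
  rewrite -mulr_sumr; have := ler_wpM2l (ler0n R N.+1) sum_hit_prob; lra.
apply: ler_sum => i _.
under eq_expect do rewrite exprMn mulrC.
rewrite expectZ.
have kh : 0 <= k * hit_prob i by rewrite mulr_ge0 ?hit_prob_ge0.
have := ler_wpM2l kh (expect_split_weight_sqr i).
have : expect P N.+1 (fun s => split_weight s i) <= 1.
  rewrite -[leRHS](expect_cst P N.+1); apply: ler_expect => s _.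
  by rewrite /split_weight phi1E invf_le1 ?ltr0n // ler1n.
move=> /(ler_wpM2l kh); lra.
Qed.

Lemma zmean_cons x s :
  zmean (split_weight (x :: s)) - zmean (split_weight s) =
  - \sum_i (hit i x)%:R * (phi R 2 (count (hit i) s) * bias i ^+ 2).
Proof.
rewrite /zmean -sumrB -sumrN; apply: eq_bigr => i _.
rewrite -mulrBl /split_weight -phi1B /=.
by case: (hit i x) => /=; rewrite ?add1n ?add0n; ring.
Qed.

(** Three moment estimates descend from order 4 to order 1; the first also passes from the [N]
    samples of Efron-Stein to [N.+1]. *)
Lemma expect_phi4 i :
  (k * hit_prob i) ^+ 3 * expect P N (fun s => phi R 4 (count (hit i) s)) <=
  expect P N.+1 (fun s => split_weight s i).
Proof.
have kh : 0 <= k * hit_prob i by rewrite mulr_ge0 ?hit_prob_ge0.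
have h4 := expect_phi_shift P (hit i) 3 N.
have h3 := expect_hits 2 i; have h2 := expect_hits 1 i.
rewrite -/(hit_prob i) in h4; set q := k * _ in kh h4 h3 h2 *.
rewrite exprS -mulrA exprS expr1.
apply: le_trans h2; rewrite -mulrA ler_wpM2l //.
by apply: le_trans h3; rewrite ler_wpM2l.
Qed.

Lemma zmean_variance :
  k ^+ 2 * expect P N.+1 (fun s => (zmean (split_weight s)
     - expect P N.+1 (zmean \o split_weight)) ^+ 2) <=
  12 * expect P N.+1 (zmean \o split_weight).
Proof.
have symm s t : perm_eq s t ->
    (zmean \o split_weight) s = (zmean \o split_weight) t.
  move=> st; apply: eq_bigr => i _; congr (_ * _).
  by rewrite /split_weight; move/permP: st => ->.
have k2 : 0 <= k ^+ 2 by rewrite exprn_ge0.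
apply: le_trans (ler_wpM2l k2 (efron_stein P N symm)) _.
rewrite -[_.+1]/(N.+1).
set e4 := fun i => expect P N (fun s => phi R 4 (count (hit i) s)).
apply: (@le_trans _ _ (k ^+ 2 * (k * \sum_i 12 * hit_prob i * bias i ^+ 4 * e4 i))).
  rewrite !ler_wpM2l //.
  apply: (@le_trans _ _ (mean P (fun x => expect P N (fun s =>
      \sum_i (hit i x)%:R * (12 * bias i ^+ 4 * phi R 4 (count (hit i) s)))))).
    apply: ler_mean => x; apply: ler_expect => s _.
    rewrite /comp zmean_cons sqrrN; apply: le_trans (sqr_sum_hit _ _) _.
    rewrite mulr_sumr; apply: ler_sum => i _; rewrite mulrCA ler_wpM2l //.
    have b4 : 0 <= bias i ^+ 4 by rewrite exprn_even_ge0.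
    have := ler_wpM2r b4 (sqr_phi2 R (count (hit i) s)).
    have -> : (phi R 2 (count (hit i) s) * bias i ^+ 2) ^+ 2 =
      phi R 2 (count (hit i) s) ^+ 2 * bias i ^+ 4 by ring.
    lra.
  under eq_mean do rewrite expect_sum.
  rewrite mean_sum; apply: ler_sum => i _.
  under eq_mean do (rewrite expectZ expectZ mulrC).
  by rewrite meanZ -/(hit_prob i) -/(e4 i); lra.
rewrite /comp expect_sum !mulr_sumr; apply: ler_sum => i _.
under [in leRHS]eq_expect do rewrite mulrC.
rewrite expectZ.
(* One factor [bias i ^+ 2] is traded for [hit_prob i ^+ 2], which completes the cube required by
   [expect_phi4]. *)
apply: (@le_trans _ _ (12 * (bias i ^+ 2 * ((k * hit_prob i) ^+ 3 * e4 i)))); last first.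
  by rewrite ler_wpM2l // ler_wpM2l ?sqr_ge0 //; exact: expect_phi4.
have e40 : 0 <= e4 i by apply: expect_ge0 => s _; exact: phi_ge0.
have k3 : 0 <= k ^+ 3 * hit_prob i by rewrite mulr_ge0 ?exprn_ge0 ?hit_prob_ge0.
have c0 := mulr_ge0 (mulr_ge0 (ler0n R 12) (sqr_ge0 (bias i))) (mulr_ge0 k3 e40).
have := ler_wpM2l c0 (sqr_bias i).
lra.
Qed.

End Flattening.
End Statistic.

(** * Majority votes and clipping *)

Section Blocks.
Context (R : realFieldType) (T : finType) (P : law R T).

Fixpoint blocks (J b : nat) (s : seq T) : seq (seq T) :=
  if J is J'.+1 then take b s :: blocks J' b (drop b s) else [::].

Lemma size_blocks J b s : size (blocks J b s) = J.
Proof. by elim: J s => //= J IH s; rewrite IH. Qed.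

Lemma count_blocks J b s u (a : pred T) :
  u \in blocks J b s -> (count a u <= count a s)%N.
Proof.
elim: J s => //= J IH s; rewrite inE => /orP[/eqP ->|/IH le1].
  by rewrite -{2}(cat_take_drop b s) count_cat leq_addr.
by apply: leq_trans le1 _; rewrite -{2}(cat_take_drop b s) count_cat leq_addl.
Qed.

Lemma expect_blocks J b (G : seq T -> R) :
  expect P (J * b) (fun s => \prod_(u <- blocks J b s) G u) = expect P b G ^+ J.
Proof.
elim: J => [|J IH]; first by rewrite expr0 /= big_nil.
rewrite mulSn expect_cat exprS mulrC -IH -expectZ; apply: eq_expect => s sb.
rewrite mulrC -expectZ; apply: eq_expect => t _.
by rewrite /= big_cons take_size_cat // drop_size_cat.
Qed.

Lemma markov N (F : seq T -> R) (c : R) : 0 < c -> (forall s, 0 <= F s) ->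
  expect P N (fun s => (c <= F s)%R%:R) <= expect P N F / c.
Proof.
move=> c0 F0; rewrite mulrC -expectZ; apply: ler_expect => s _.
case: (leP c (F s)) => /= [cF|_]; last by rewrite mulr_ge0 // invr_ge0 ltW.
by rewrite mulrC ler_pdivlMr // mul1r.
Qed.

(* Exponential Markov inequality with base 16: the indicator of a bad majority
   is at most [4 ^- J * 16 ^ (number of bad blocks)]. *)
Lemma majority_bound J b (bad : pred (seq T)) :
  expect P b (fun u => (bad u)%:R) <= 16^-1 ->
  expect P (J * b) (fun s => (J <= 2 * count bad (blocks J b s))%N%:R) <= 2^-1 ^+ J.
Proof.
move=> small.
apply: (@le_trans _ _ (4^-1 ^+ J * expect P (J * b) (fun s =>
    \prod_(u <- blocks J b s) (1 + 15 * (bad u)%:R)))).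
  rewrite -expectZ; apply: ler_expect => s _.
  have -> : \prod_(u <- blocks J b s) (1 + 15 * (bad u)%:R) =
      4 ^+ (2 * count bad (blocks J b s)) :> R.
    elim: (blocks J b s) => [|u l IH]; first by rewrite big_nil.
    rewrite big_cons IH /= mulnDr exprD.
    by case: (bad u); rewrite /= ?mulr1 ?mulr0 ?addr0 ?muln1 ?muln0 //; congr (_ * _); ring.
  have p0 k : 0 < 4 ^+ k :> R by rewrite exprn_gt0.
  rewrite exprVn mulrC ler_pdivlMr ?p0 //.
  case: leqP => [le1|_]; last by rewrite mul0r ltW.
  by rewrite mul1r ler_weXn2l // ler1n.
have e0 : 0 <= expect P b (fun u => 1 + 15 * (bad u)%:R).
  by apply: expect_ge0 => u _; apply: addr_ge0 => //; apply: mulr_ge0.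
(* Each block contributes at most (1 + 15/16)/4 < 1/2. *)
rewrite expect_blocks -exprMn; apply: lerXn2r.
- by rewrite nnegrE mulr_ge0 ?invr_ge0.
- by rewrite nnegrE invr_ge0.
rewrite expectD expect_cst expectZ; lra.
Qed.

Lemma majority_all (l : seq (seq T)) (bad Q : pred (seq T)) :
  (2 * count bad l < size l)%N -> (forall u, ~~ bad u -> Q u) ->
  (size l < 2 * count Q l)%N.
Proof.
move=> few badQ.
have := count_predC bad l.
have : (count (predC bad) l <= count Q l)%N by apply: sub_count.
lia.
Qed.

Lemma majority_none (l : seq (seq T)) (bad Q : pred (seq T)) :
  (2 * count bad l < size l)%N -> (forall u, Q u -> bad u) ->
  (size l < 2 * count Q l)%N = false.
Proof.
move=> few Qbad.
have : (count Q l <= count bad l)%N by apply: sub_count.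
lia.
Qed.

End Blocks.

(** * Clipping to the range of the threshold *)

Section Clip.
Context (R : realFieldType).
Implicit Types x y rho kap : R.

(** For almost every threshold in [2, 3], comparing [x] or [clip x] with it gives the same
    answer. *)
Definition clip x : R := if x <= 2 then 2 else if x <= 3 then x else 3.

Lemma clip_le2 x : x <= 2 -> clip x = 2.
Proof. by rewrite /clip => ->. Qed.

Lemma clip_ge3 x : 3 <= x -> clip x = 3.
Proof.
rewrite /clip => x3; case: (leP x 2) => [x2|_]; first by exfalso; lra.
by case: (leP x 3) => // ?; lra.
Qed.

Lemma clip_bounds x : 2 <= clip x <= 3.
Proof.
by rewrite /clip; case: (leP x 2) => h2; [|case: (leP x 3) => h3];
  apply/andP; split; lra.
Qed.

(** Clipping is 1-Lipschitz, which suffices for [y <= 3]; beyond 3 the clipped distance is at most 1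
    while [x] must lie far below [y] to matter. The gain [1 + y] absorbs a variance growing with the
    mean. *)
Lemma clip_dist x y : 0 <= y -> `|clip x - clip y| * (1 + y) <= 4 * `|x - y|.
Proof.
move=> y0.
have [xy|xy] := leP y x.
  rewrite [`|x - y|]ger0_norm ?subr_ge0 //.
  rewrite ger0_norm; last by rewrite /clip;
    case: (leP x 2) => x2; [|case: (leP x 3) => x3];
    (case: (leP y 2) => y2; [|case: (leP y 3) => y3]); lra.
  by rewrite /clip; case: (leP x 2) => x2; [|case: (leP x 3) => x3];
    (case: (leP y 2) => y2; [|case: (leP y 3) => y3]); nra.
rewrite [`|x - y|]ltr0_norm ?subr_lt0 //.
rewrite ler0_norm; last by rewrite /clip; case: (leP x 2) => x2; [|case: (leP x 3) => x3];
    (case: (leP y 2) => y2; [|case: (leP y 3) => y3]); lra.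
by rewrite /clip; case: (leP x 2) => x2; [|case: (leP x 3) => x3];
    (case: (leP y 2) => y2; [|case: (leP y 3) => y3]); nra.
Qed.

(* AM-GM in the form [160 z rho <= (80 z)^2 + rho^2] trades the first moment for
   the second one. *)
Lemma clip_dist_sqr x y rho : 0 <= y -> 0 < rho ->
  `|clip x - clip y| <= 160 / (rho * (1 + y) ^+ 2) * (x - y) ^+ 2 + rho / 40.
Proof.
move=> y0 r0; set a := `|_ - _|.
have := clip_dist x y0; rewrite -/a -[(x - y) ^+ 2]real_normK ?num_real //.
set b := `|x - y| => ab.
have y1 : 0 < 1 + y by lra.
have {}ab : a <= 4 * (b / (1 + y)) by rewrite mulrA ler_pdivlMr.
have -> : 160 / (rho * (1 + y) ^+ 2) * b ^+ 2 = 160 * (b / (1 + y)) ^+ 2 / rho.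
  by field; rewrite !gt_eqF.
set z := b / (1 + y) in ab *.
apply: le_trans ab _.
rewrite -(ler_pM2r r0) [leRHS]mulrDl divfK ?gt_eqF //.
have := sqr_ge0 (80 * z - rho); lra.
Qed.

End Clip.

(** * The decision statistic *)

Section DecisionStatistic.
Context (R : realFieldType) (n : nat) (theta : R) (k L m0 : nat).
Local Notation T := ('I_n * 'I_n)%type.
Implicit Types (F A B V u : seq T).

Definition estimate m (w : 'I_n -> R) A B : R := zstat w A B / (m%:R ^+ 2 * theta).

Definition block_estimate F u : R :=
  estimate m0 (split_weight R F) (take m0 u) (drop m0 u).

(** The cutoffs 1 and 4 leave room around [2, 3]: a block accurate within [(1 + g) / 10], with [g]
    the scaled mean, cannot vote low when [g >= 2] nor high when [g <= 3]. *)
Definition decision_stat F A B V : R :=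
  let bs := blocks L (m0 + m0) V in
  if (L < 2 * count (fun u => block_estimate F u <= 1)%R bs)%N then 0
  else if (L < 2 * count (fun u => 4 <= block_estimate F u)%R bs)%N then 5
  else estimate k (split_weight R F) A B.

End DecisionStatistic.

(** * Concentration of the decision statistic *)

Section Analysis.
Context (R : realFieldType) (n : nat) (P : law R ('I_n * 'I_n)%type).
Context (theta rho kap kap0 : R) (b L m0 : nat).
Local Notation T := ('I_n * 'I_n)%type.
Local Notation k := (L * b)%N.
Local Notation sw := (@split_weight R n).
Local Notation spread := (Num.min n%:R (2 * k%:R) / k%:R ^+ 2 : R).
Implicit Types (F A B V u : seq T).

Context (n_gt0 : (0 < n)%N) (b_gt0 : (0 < b)%N) (L_gt0 : (0 < L)%N) (m0_gt0 : (0 < m0)%N).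
Context (theta_gt0 : 0 < theta) (rho_gt0 : 0 < rho) (kap0_gt0 : 0 < kap0).
Context (kap0_small : 128 * (100 * kap0) <= 1) (kap_small : 1000 * (1000 * kap) <= 1).
(** [vote_size] makes one vote accurate up to a constant; [spread_small] and [size_large] make the
    main estimate accurate up to a small multiple of [rho]. Twice [spread] bounds the mean of
    [zvar]. *)
Context (vote_size : 4 * L%:R ^+ 2 * spread <= (kap0 * (m0%:R * theta)) ^+ 2).
Context (spread_small : spread <= kap * (rho * (k%:R * theta)) ^+ 2).
Context (size_large : 1 <= kap * (rho * k%:R) ^+ 2 * theta).

Definition scaled_mean F : R := zmean P (sw F) / theta.
(** Being independent of all samples, it is a common reference point for two runs with different
    flattening samples. *)
Definition target : R := expect P k scaled_mean.
Definition flat_bad F : bool := 4 * L%:R ^+ 2 * spread <= zvar P (sw F).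
Definition block_bad F u : bool :=
  (1 + scaled_mean F) / 10 <= `|block_estimate theta m0 F u - scaled_mean F|.
Definition bad F V : bool :=
  flat_bad F || (L <= 2 * count (block_bad F) (blocks L (m0 + m0) V))%N.

Let k_gt0 : (0 < k)%N. Proof. by rewrite muln_gt0 L_gt0. Qed.
Let kR_gt0 : 0 < k%:R :> R. Proof. by rewrite ltr0n. Qed.

Let spread_gt0 : 0 < spread.
Proof. by apply: divr_gt0; rewrite ?exprn_gt0 // lt_min mulr_gt0 // ltr0n n_gt0. Qed.

Let kap_rho_ge0 : 0 <= kap * rho ^+ 2.
Proof.
have kt : 0 < k%:R ^+ 2 * theta by rewrite mulr_gt0 ?exprn_gt0.
rewrite -(pmulr_lge0 _ kt); apply: le_trans ler01 (le_trans size_large _).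
by rewrite le_eqVlt; apply/orP; left; apply/eqP; ring.
Qed.

Let sw_ge0 F i : 0 <= sw F i. Proof. exact: phi_ge0. Qed.
Let swh_ge0 F i : 0 <= sw F i * hit_prob P i.
Proof. exact: mulr_ge0 (sw_ge0 F i) (hit_prob_ge0 P i). Qed.

Lemma scaled_mean_ge0 F : 0 <= scaled_mean F.
Proof.
apply: divr_ge0; last exact: ltW.
by apply: sumr_ge0 => i _; rewrite mulr_ge0 ?sqr_ge0 ?phi_ge0.
Qed.

Lemma target_ge0 : 0 <= target.
Proof. by apply: expect_ge0 => s _; exact: scaled_mean_ge0. Qed.

Lemma targetE : target = expect P k (zmean P \o sw) / theta.
Proof. by rewrite mulrC -expectZ; apply: eq_expect => s _; rewrite mulrC. Qed.

Lemma expect_zvar_split N : (0 < N)%N ->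
  expect P N (zvar P \o sw) <= 2 * (Num.min n%:R (2 * N%:R) / N%:R ^+ 2).
Proof.
case: N => // N _.
have N2 : 0 < N.+1%:R ^+ 2 :> R by rewrite exprn_gt0.
rewrite mulrA ler_pdivlMr // mulrC.
case: (leP n%:R (2 * N.+1%:R : R)) => _; first exact: expect_zvar_card.
by apply: le_trans (expect_zvar_size P N) _; lra.
Qed.

(** More hits mean smaller weights, so a large [zvar] for the whole flattening sample forces a large
    one for each piece. *)
Lemma zvar_split_anti F u : (forall i, (count (hit i) u <= count (hit i) F)%N) ->
  zvar P (sw F) <= zvar P (sw u).
Proof.
move=> le_uF; apply: ler_sum => i _.
apply: lerXn2r; rewrite ?nnegrE ?swh_ge0 //.
apply: ler_wpM2r; first exact: hit_prob_ge0.
by rewrite /split_weight !phi1E lef_pV2 ?posrE ?ltr0n // ler_nat ltnS.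
Qed.

(* The [L] consecutive pieces of the flattening sample must all be bad. *)
Lemma flat_bad_prob : expect P k (fun F => (flat_bad F)%:R) <= 2^-1 ^+ L.
Proof.
pose piece_bad u : bool := 4 * L%:R ^+ 2 * spread <= zvar P (sw u).
apply: (@le_trans _ _ (expect P k (fun F =>
    \prod_(u <- blocks L b F) (piece_bad u)%:R))).
  apply: ler_expect => F _; rewrite /flat_bad.
  case: (boolP (_ <= zvar P (sw F))) => [badF|_]; last by apply: prodr_ge0.
  rewrite big_seq big1 // => u uF; suff -> : piece_bad u by [].
  by apply: le_trans badF _; apply: zvar_split_anti => i; exact: count_blocks uF.
rewrite expect_blocks lerXn2r ?nnegrE ?invr_ge0 ?expect_ge0 //.
have c0 : 0 < 4 * L%:R ^+ 2 * spread.
  by rewrite mulr_gt0 // mulr_gt0 // exprn_gt0 // ltr0n.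
apply: le_trans (markov P b c0 (fun u => zvar_ge0 P (sw u))) _.
rewrite ler_pdivrMr //; apply: le_trans (expect_zvar_split b_gt0) _.
have bR : 0 < b%:R :> R by rewrite ltr0n.
have LR : 0 < L%:R :> R by rewrite ltr0n.
(* Since [k = L * b], the cutoff in [flat_bad] is at least twice the bound on the mean of [zvar] for
   a piece of size [b], and Markov's inequality gives 1/2. *)
have -> : 2^-1 * (4 * L%:R ^+ 2 * spread) = 2 * (Num.min n%:R (2 * k%:R) / b%:R ^+ 2).
  by rewrite natrM; field; rewrite !gt_eqF.
rewrite ler_pM2l // ler_pM2r ?invr_gt0 ?exprn_gt0 //.
rewrite le_min ge_min lexx /= ge_min; apply/orP; right.
by rewrite ler_pM2l // ler_nat leq_pmull.
Qed.

(** Chebyshev's inequality given [F]. As [zvar] is at most [z ^+ 2], so is each of its terms; hence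
    every [w i * hit_prob i] is at most [z], and [zcross] is at most [z] times [zmean]. *)
Lemma block_bad_prob F : ~~ flat_bad F ->
  expect P (m0 + m0) (fun u => (block_bad F u)%:R) <= 16^-1.
Proof.
rewrite /flat_bad -ltNge => /ltW /le_trans /(_ vote_size).
set z := kap0 * _ => zvz.
have mt : 0 < m0%:R * theta :> R by rewrite mulr_gt0 ?ltr0n.
have z0 : 0 < z by rewrite mulr_gt0.
have wh i : sw F i * hit_prob P i <= z.
  rewrite -(@ler_pXn2r _ 2) ?nnegrE ?(ltW z0) ?swh_ge0 //.
  apply: le_trans zvz; rewrite /zvar (bigD1 i) //= lerDl.
  by apply: sumr_ge0 => j _; exact: sqr_ge0.
have cross : zcross P (sw F) <= z * zmean P (sw F).
  rewrite /zcross /zmean mulr_sumr; apply: ler_sum => i _.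
  have -> : sw F i ^+ 2 * bias P i ^+ 2 * hit_prob P i =
    (sw F i * hit_prob P i) * (sw F i * bias P i ^+ 2) by ring.
  by apply: ler_wpM2r (wh i); rewrite mulr_ge0 ?sw_ge0 ?sqr_ge0.
set g := scaled_mean F.
have g0 : 0 <= g := scaled_mean_ge0 F.
have gE : zmean P (sw F) = theta * g by rewrite /g /scaled_mean mulrC divfK ?gt_eqF.
have c0 : 0 < ((1 + g) / 10) ^+ 2 by rewrite exprn_gt0 // divr_gt0 //; lra.
apply: (@le_trans _ _ (expect P (m0 + m0) (fun u =>
    (((1 + g) / 10) ^+ 2 <= (block_estimate theta m0 F u - g) ^+ 2)%R%:R))).
  apply: ler_expect => u _; rewrite /block_bad -/g.
  case: (boolP (_ <= `|_|)) => // le1.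
  rewrite -[(block_estimate _ _ _ _ - _) ^+ 2]real_normK ?num_real //.
  by rewrite lerXn2r // nnegrE // divr_ge0 // addr_ge0.
apply: le_trans (markov P _ c0 (fun u => sqr_ge0 _)) _.
rewrite ler_pdivrMr // expect_cat.
pose M : R := m0%:R ^+ 2 * theta.
have M0 : 0 < M by rewrite mulr_gt0 ?exprn_gt0 ?ltr0n.
have -> : expect P m0 (fun s => expect P m0 (fun t =>
    (block_estimate theta m0 F (s ++ t) - g) ^+ 2)) =
   M ^- 2 * expect P m0 (fun s => expect P m0 (fun t =>
    (zstat (sw F) s t - m0%:R ^+ 2 * zmean P (sw F)) ^+ 2)).
  rewrite -expectZ; apply: eq_expect => s sm; rewrite -expectZ; apply: eq_expect => t _.
  rewrite /block_estimate take_size_cat // drop_size_cat // gE /estimate -/M.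
  rewrite mulrA -/M; by field; rewrite gt_eqF.
rewrite mulrC ler_pdivrMr ?exprn_gt0 //.
apply: le_trans (zstat_variance P m0 (sw F)) _.
have m2 : 0 <= 4 * m0%:R ^+ 2 :> R by rewrite mulr_ge0 ?exprn_ge0.
have m3 : 0 <= 8 * m0%:R ^+ 3 :> R by rewrite mulr_ge0 ?exprn_ge0.
apply: le_trans (lerD (ler_wpM2l m2 zvz) (ler_wpM2l m3 cross)) _.
have -> : 4 * m0%:R ^+ 2 * z ^+ 2 + 8 * m0%:R ^+ 3 * (z * zmean P (sw F)) =
   M ^+ 2 * (4 * kap0 ^+ 2 + 8 * kap0 * g) by rewrite gE /z /M; ring.
rewrite mulrC ler_pM2r ?exprn_gt0 //.
have kap0_le1 : kap0 <= 1 by have := kap0_small; have := kap0_gt0; lra.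
have kk : kap0 * kap0 <= kap0 by rewrite ler_piMr ?(ltW kap0_gt0).
have kg : 0 <= kap0 * g by rewrite mulr_ge0 // ltW.
have kg2 : 0 <= kap0 * g * g by rewrite mulr_ge0.
have : 128 * (100 * kap0) * (1 + g) ^+ 2 <= (1 + g) ^+ 2.
  by rewrite ler_piMl ?sqr_ge0.
lra.
Qed.

Lemma bad_prob :
  expect P k (fun F => expect P (L * (m0 + m0)) (fun V => (bad F V)%:R)) <=
  2 * 2^-1 ^+ L.
Proof.
apply: (@le_trans _ _ (expect P k (fun F => (flat_bad F)%:R + 2^-1 ^+ L))); last first.
  by rewrite expectD expect_cst; have := flat_bad_prob; lra.
apply: ler_expect => F _; rewrite /bad.
case: (boolP (flat_bad F)) => [_|good] /=.
  by rewrite expect_cst lerDl exprn_ge0 ?invr_ge0.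
rewrite add0r; apply: majority_bound; exact: block_bad_prob.
Qed.

Local Notation W F A B V := (decision_stat theta k L m0 F A B V).

Let block_bad_low F u : 2 <= scaled_mean F -> block_estimate theta m0 F u <= 1 ->
  block_bad F u.
Proof.
move=> g2 e1; rewrite /block_bad distrC ger0_norm; lra.
Qed.

Lemma few_bad F V : ~~ bad F V ->
  (2 * count (block_bad F) (blocks L (m0 + m0) V) < size (blocks L (m0 + m0) V))%N.
Proof. by rewrite size_blocks /bad negb_or -ltnNge => /andP[]. Qed.

(** Outside [bad] the votes alone fix the value, whatever [A] and [B] are; this lemma and the next
    one therefore give error probabilities as small as that of [bad]. *)
Lemma decision_stat_null F A B V : ~~ bad F V -> scaled_mean F = 0 -> W F A B V = 0.
Proof.
move=> /few_bad few g0; rewrite /decision_stat.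
have := majority_all (Q := fun u => block_estimate theta m0 F u <= 1) few.
rewrite size_blocks => -> // u; rewrite /block_bad g0 -ltNge subr0 => h.
by apply: le_trans (ler_norm _) _; lra.
Qed.

Lemma decision_stat_far F A B V : ~~ bad F V -> 5 <= scaled_mean F -> W F A B V = 5.
Proof.
move=> /few_bad few g5; rewrite /decision_stat.
have := majority_none (Q := fun u => block_estimate theta m0 F u <= 1) few.
rewrite size_blocks => ->; last by move=> u; apply: block_bad_low; lra.
have := majority_all (Q := fun u => 4 <= block_estimate theta m0 F u) few.
rewrite size_blocks => -> // u; rewrite /block_bad -ltNge ltr_norml => /andP[h _].
lra.
Qed.

(** A majority for low forces the scaled mean below 2, and one for high forces it above 3. So an
    overriding value 0 or 5 has the same clipping as the scaled mean. *)
Lemma clip_decision_stat F A B V : ~~ bad F V ->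
  `|clip (W F A B V) - clip target| <=
  `|clip (estimate theta k (sw F) A B) - clip target| +
  `|clip (scaled_mean F) - clip target|.
Proof.
move=> /few_bad few; rewrite /decision_stat.
have := majority_none (Q := fun u => block_estimate theta m0 F u <= 1) few.
have := majority_none (Q := fun u => 4 <= block_estimate theta m0 F u) few.
rewrite size_blocks; set lo := (_ < _)%N; set hi := (_ < _)%N => hiP loP.
(* Here [hi] is the majority for an estimate [<= 1], and [lo] that for an estimate [>= 4]. *)
have [lo_true|_] := boolP hi.
  have g2 : scaled_mean F < 2.
    rewrite ltNge; apply/negP => g2; move: lo_true; rewrite loP // => u.
    exact: block_bad_low.
  have -> : clip 0 = clip (scaled_mean F) :> R.
    by rewrite !clip_le2 ?(ltW g2).
  by rewrite lerDr.
have [hi_true|_] := boolP lo; last by rewrite lerDl.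
have g3 : 3 < scaled_mean F.
  rewrite ltNge; apply/negP => g3; move: hi_true; rewrite hiP // => u e4.
  rewrite /block_bad ger0_norm; lra.
have -> : clip 5 = clip (scaled_mean F) :> R.
  by rewrite !clip_ge3 ?(ltW g3) // ler_nat.
by rewrite lerDr.
Qed.

Lemma scaled_mean_variance :
  expect P k (fun F => (scaled_mean F - target) ^+ 2) <= 12 * kap * rho ^+ 2 * target.
Proof.
have -> : expect P k (fun F => (scaled_mean F - target) ^+ 2) =
   theta ^- 2 * expect P k (fun F => (zmean P (sw F)
     - expect P k (zmean P \o sw)) ^+ 2).
  rewrite -expectZ; apply: eq_expect => F _; rewrite targetE /scaled_mean.
  by field; rewrite gt_eqF.
have := zmean_variance P k.-1; rewrite prednK // => h.
have t2 : 0 < theta ^+ 2 by rewrite exprn_gt0.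
rewrite mulrC ler_pdivrMr // -(@ler_pM2l _ (k%:R ^+ 2)) ?exprn_gt0 //.
apply: le_trans h _.
have -> : expect P k (zmean P \o sw) = theta * target.
  by rewrite targetE mulrC divfK ?gt_eqF.
have tt : 0 <= theta * target by rewrite mulr_ge0 ?target_ge0 // ltW.
have := ler_wpM2r tt size_large; lra.
Qed.

(** The [zvar] part is charged to [spread_small], the [zcross] part to [size_large]; the latter is
    proportional to [target]. *)
Lemma estimate_cond_variance :
  expect P k (fun F => expect P k (fun A => expect P k (fun B =>
    (estimate theta k (sw F) A B - scaled_mean F) ^+ 2))) <=
  16 * kap * rho ^+ 2 * (1 + target).
Proof.
pose M : R := k%:R ^+ 2 * theta.
have M0 : 0 < M by rewrite mulr_gt0 ?exprn_gt0 ?ltr0n.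
apply: (@le_trans _ _ (expect P k (fun F => M ^- 2 *
   (4 * k%:R ^+ 2 * zvar P (sw F) + 8 * k%:R ^+ 3 * zcross P (sw F))))).
  apply: ler_expect => F _.
  apply: (le_trans _ (ler_wpM2l _ (zstat_variance P k (sw F)))); last first.
    by rewrite invr_ge0 exprn_ge0 // ltW.
  rewrite -expectZ; apply: ler_expect => A _; rewrite -expectZ; apply: ler_expect => B _.
  rewrite le_eqVlt; apply/orP; left; apply/eqP.
  rewrite /estimate -/M (_ : scaled_mean F = k%:R ^+ 2 * zmean P (sw F) / M).
    by field; rewrite gt_eqF.
  rewrite /scaled_mean /M; field.
by rewrite !gt_eqF ?ltr0n.
rewrite expectZ expectD !expectZ mulrC ler_pdivrMr ?exprn_gt0 //.
have h1 := expect_zvar_split k_gt0.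
have := expect_zcross P k.-1; rewrite prednK // => h2.
have eg : expect P k (zmean P \o sw) = theta * target.
  by rewrite targetE mulrC divfK ?gt_eqF.
rewrite eg in h2.
have k2 : 0 <= k%:R ^+ 2 :> R by rewrite exprn_ge0.
have tt : 0 <= theta * target by rewrite mulr_ge0 ?target_ge0 // ltW.
have tk : 0 <= 16 * k%:R ^+ 2 * (theta * target) by rewrite mulr_ge0 // mulr_ge0.
have e1 := ler_wpM2l k2 h1.
have e2 := ler_wpM2l k2 h2.
have e3 := ler_wpM2l k2 spread_small.
have e4 := ler_wpM2l tk size_large.
have e5 : 0 <= kap * (rho * (k%:R * theta)) ^+ 2 * k%:R ^+ 2.
  by rewrite mulrC; apply: le_trans e3; rewrite mulr_ge0 // ltW.
rewrite /comp in h1 e1 h2 e2; rewrite /M; lra.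
Qed.

Lemma estimate_variance :
  expect P k (fun F => expect P k (fun A => expect P k (fun B =>
    (estimate theta k (sw F) A B - target) ^+ 2))) <=
  56 * kap * rho ^+ 2 * (1 + target).
Proof.
have t0 := target_ge0.
apply: (@le_trans _ _ (expect P k (fun F =>
   2 * (expect P k (fun A => expect P k (fun B =>
    (estimate theta k (sw F) A B - scaled_mean F) ^+ 2))) +
   2 * (scaled_mean F - target) ^+ 2))).
  apply: ler_expect => F _.
  have -> : 2 * (scaled_mean F - target) ^+ 2 =
     expect P k (fun A => expect P k (fun B => 2 * (scaled_mean F - target) ^+ 2)).
    by rewrite !expect_cst.
  rewrite -expectZ -expectD; apply: ler_expect => A _.
  rewrite -expectZ -expectD; apply: ler_expect => B _.
  set e := estimate _ _ _ _ _; set g := scaled_mean F.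
  by have := sqr_ge0 ((e - g) - (g - target)); lra.
rewrite expectD !expectZ.
have := scaled_mean_variance; have := estimate_cond_variance.
have := kap_rho_ge0.
lra.
Qed.

(** The square of [1 + target] in the denominator beats the single factor in the variance, and 160 *
    56 = 8960 is at most a fortieth of 1000 * 1000. *)
Let clip_coef (v : R) : v <= 56 * kap * rho ^+ 2 * (1 + target) -> 0 <= v ->
  160 / (rho * (1 + target) ^+ 2) * v + rho / 40 <= rho / 20.
Proof.
move=> hv v0; have t0 := target_ge0.
have d0 : 0 < rho * (1 + target) ^+ 2 by rewrite mulr_gt0 ?exprn_gt0 //; lra.
suff : 160 / (rho * (1 + target) ^+ 2) * v <= rho / 40 by lra.
rewrite mulrAC ler_pdivrMr //.
have r2 : 0 < rho ^+ 2 by rewrite exprn_gt0.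
have h1 : 160 * v <= 8960 * kap * (rho ^+ 2 * (1 + target)) by lra.
apply: le_trans h1 _.
have q1 : 0 <= rho ^+ 2 * (1 + target) by rewrite mulr_ge0 ?ltW //; lra.
have h2 : 8960 * kap <= 1 / 40 by have := kap_small; lra.
apply: le_trans (ler_wpM2r q1 h2) _.
have : 0 <= rho ^+ 2 * target by rewrite mulr_ge0 // ltW.
have : 0 <= rho ^+ 2 * target ^+ 2 by rewrite mulr_ge0 ?sqr_ge0 // ltW.
lra.
Qed.

Lemma clip_decision_stat_expect :
  expect P k (fun F => expect P k (fun A => expect P k (fun B =>
    expect P (L * (m0 + m0)) (fun V => `|clip (W F A B V) - clip target|)))) <=
  rho / 10 + 2 * 2^-1 ^+ L.
Proof.
have t0 := target_ge0.
pose c : R := 160 / (rho * (1 + target) ^+ 2).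
have d0 : 0 < rho * (1 + target) ^+ 2 by rewrite mulr_gt0 ?exprn_gt0 //; lra.
apply: (@le_trans _ _ (expect P k (fun F =>
   (c * expect P k (fun A => expect P k (fun B =>
      (estimate theta k (sw F) A B - target) ^+ 2)) + rho / 40) +
   ((c * (scaled_mean F - target) ^+ 2 + rho / 40) +
   expect P (L * (m0 + m0)) (fun V => (bad F V)%:R))))).
  apply: ler_expect => F _.
  pose r : R := (c * (scaled_mean F - target) ^+ 2 + rho / 40) +
   expect P (L * (m0 + m0)) (fun V => (bad F V)%:R).
  apply: (@le_trans _ _ (expect P k (fun A => expect P k (fun B =>
     (c * (estimate theta k (sw F) A B - target) ^+ 2 + rho / 40) + r)))); last first.
    rewrite -/r -expectZ.
    apply: (@le_trans _ _ (expect P k (fun A => c * expect P k (fun B =>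
      (estimate theta k (sw F) A B - target) ^+ 2) + (rho / 40 + r)))).
      apply: ler_expect => A _; rewrite -expectZ.
      by rewrite !expectD !expect_cst /r !addrA.
    by rewrite expectD expect_cst addrA.
  apply: ler_expect => A _; apply: ler_expect => B _.
  pose q : R := (c * (estimate theta k (sw F) A B - target) ^+ 2 + rho / 40) +
    (c * (scaled_mean F - target) ^+ 2 + rho / 40).
  rewrite /r addrA -/q -[q](expect_cst P (L * (m0 + m0))) -expectD.
  apply: ler_expect => V _.
  have q1 := clip_dist_sqr (estimate theta k (sw F) A B) t0 rho_gt0.
  have q2 := clip_dist_sqr (scaled_mean F) t0 rho_gt0.
  have := @clip_decision_stat F A B V.
  case: (bad F V) => [_|/(_ isT) h] /=; last by rewrite /q /c; lra.
  have q0 : 0 <= q.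
    by rewrite /q /c; have := normr_ge0 (clip (scaled_mean F) - clip target);
      have := normr_ge0 (clip (estimate theta k (sw F) A B) - clip target); lra.
  have /andP[a1 a2] := clip_bounds (W F A B V).
  have /andP[b1 b2] := clip_bounds target.
  (* On the bad event only the length of [2, 3] is available; it is paid for by the indicator of
     [bad]. *)
  suff : `|clip (W F A B V) - clip target| <= 1 by lra.
  by rewrite ler_norml; apply/andP; split; lra.
rewrite expectD (expectD _ k (fun F => c * _)) expectZ expect_cst.
rewrite expectD (expectD _ k (fun F => c * _)) expectZ expect_cst.
have := bad_prob.
have := clip_coef estimate_variance; have := scaled_mean_variance.
have kr : 0 <= kap * rho ^+ 2 * target.
  have v0 : 0 <= expect P k (fun F => (scaled_mean F - target) ^+ 2).
    by apply: expect_ge0 => s _; exact: sqr_ge0.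
  have := le_trans v0 scaled_mean_variance; lra.
have kr1 := kap_rho_ge0.
move=> h1 h2 h3.
have := h2 (expect_ge0 P (fun F _ => expect_ge0 P (fun A _ =>
  expect_ge0 P (fun B _ => sqr_ge0 _)))).
have h4 : expect P k (fun F => (scaled_mean F - target) ^+ 2) <=
  56 * kap * rho ^+ 2 * (1 + target) by lra.
have := clip_coef h4 (expect_ge0 P (fun F _ => sqr_ge0 _)).
rewrite -/c !(expectZ P k c); lra.
Qed.

End Analysis.

(** * Random threshold *)

Section ThresholdTester.
Local Open Scope classical_set_scope.
Context (R : realType).

Let lt23 : 2 < 3 :> R. Proof. by rewrite ltr_nat. Qed.

Definition threshold_law : probability (measurableTypeR R) R := uniform_prob lt23.

Lemma measurable_le_threshold (a : R) :
  measurable_fun [set: measurableTypeR R] (fun r : measurableTypeR R => a <= r).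
Proof. exact: measurable_fun_ler. Qed.

Definition threshold_tester (n m : nat) (f : samples n m -> R) : tester R n m :=
  @Tester R n m _ (measurableTypeR R) threshold_law (fun X r => f X <= r)
    (fun X => measurable_le_threshold (f X)).

Lemma threshold_law1 (U : set (measurableTypeR R)) :
  `[2, 3]%classic `<=` U -> threshold_law U = 1%E.
Proof. by move=> sub; apply: integral_uniform_pdf1. Qed.

Lemma threshold_law_itv (u v : R) : 2 <= u -> u <= v -> v <= 3 ->
  threshold_law `[u, v]%classic = (v - u)%:E.
Proof.
move=> u2 uv v3; rewrite /threshold_law /= /uniform_prob.
rewrite (eq_integral (cst 1%E)); last first.
  move=> x; rewrite inE /= in_itv /= => /andP[ux xv].
  rewrite /uniform_pdf (le_trans u2 ux) (le_trans xv v3) /=.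
  by rewrite (_ : 3 - 2 = 1 :> R) ?invr1 //; lra.
rewrite integral_cst //= mul1e lebesgue_measure_itv /= lte_fin.
by case: ltP => [//|vu]; rewrite (_ : v - u = 0) //; lra.
Qed.

(** Thresholds in [2, 3] on which the two comparisons differ lie between [clip a] and [clip b]. The
    agreement set and this interval thus cover [2, 3], and subadditivity concludes. *)
Lemma threshold_law_agree (a b : R) :
  1 - `|clip a - clip b| <= fine (threshold_law [set r | (a <= r) = (b <= r)]).
Proof.
wlog ab : a b / a <= b => [wl|].
  case: (leP a b) => [/wl //|/ltW/wl].
  rewrite distrC (_ : [set r | (b <= r) = (a <= r)] = [set r | (a <= r) = (b <= r)]) //.
  by apply/seteqP; split => r /=.
have [/andP[a2 a3] /andP[b2 b3]] := (clip_bounds a, clip_bounds b).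
have cab : clip a <= clip b.
  rewrite /clip; case: (leP a 2) => x2; [|case: (leP a 3) => x3];
    (case: (leP b 2) => y2; [|case: (leP b 3) => y3]); lra.
set U := [set _ | _].
have mU : measurable U.
  have -> : U = `[b, +oo[%classic `|` `]-oo, a[%classic.
    apply/seteqP; split => r /=; rewrite !in_itv /= andbT.
      by case: (leP a r) => [ar|ra]; [move=> <-; left | right].
    rewrite /U /=; case=> [br|ra]; first by rewrite br (le_trans ab br).
    by rewrite !leNgt ra (lt_le_trans ra ab).
  by apply: measurableU; exact: measurable_itv.
have : (1 <= threshold_law U + threshold_law `[clip a, clip b]%classic)%E.
  rewrite -(@threshold_law1 (U `|` `[clip a, clip b]%classic)); last first.
    move=> r /=; rewrite !in_itv /= => /andP[r2 r3].
    have [ar|ra] := leP a r; have [br|rb] := leP b r; try by left; rewrite /U /= ?ar ?br.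
    - right; rewrite /clip; case: (leP a 2) => x2; [|case: (leP a 3) => x3];
        (case: (leP b 2) => y2; [|case: (leP b 3) => y3]); apply/andP; split; lra.
    - by have := lt_le_trans ra ab; lra.
    - by left; rewrite /U /= leNgt ra leNgt rb.
  exact: measureU2.
rewrite threshold_law_itv // -[threshold_law U]fineK ?fin_num_measure //.
rewrite -EFinD lee_fin distrC ger0_norm ?subr_ge0 //; lra.
Qed.

End ThresholdTester.

(** * From sample functions to lists *)

Section Transfer.
Context (R : realFieldType) (T : finType) (P : law R T).

Lemma expect_tuple m (F : seq T -> R) :
  \sum_(t : m.-tuple T) (\prod_(x <- t) P x) * F t = expect P m F.
Proof.
elim: m F => [|m IH] F.
  rewrite (bigD1 [tuple]) //= big_nil mul1r big1 ?addr0 // => t.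
  by case/eqP; exact: tuple0.
rewrite (reindex (fun y : T * m.-tuple T => [tuple of y.1 :: y.2])) /=; last first.
  exists (fun t : m.+1.-tuple T => (thead t, [tuple of behead t])) => [[x t] _|t _].
    by congr (_, _); apply: val_inj.
  by rewrite [in RHS](tuple_eta t).
rewrite -(pair_big xpredT xpredT
  (fun x (t : m.-tuple T) => (\prod_(y <- x :: t) P y) * F (x :: t))) /=.
apply: eq_bigr => x _; rewrite -IH mulr_sumr; apply: eq_bigr => t _.
by rewrite big_cons mulrA.
Qed.

Lemma expect_ffun m (F : seq T -> R) :
  \sum_(X : {ffun 'I_m -> T}) (\prod_(i < m) P (X i)) * F (codom X) = expect P m F.
Proof.
rewrite -expect_tuple (reindex (fun t : m.-tuple T => [ffun i => tnth t i])) /=.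
  apply: eq_bigr => t _.
  have -> : codom [ffun i => tnth t i] = t.
    rewrite codomE -[RHS]map_tnth_enum; apply: eq_map => i; exact: ffunE.
  by rewrite big_tuple; congr (_ * _); apply: eq_bigr => i _; rewrite ffunE.
exists (fun X : {ffun 'I_m -> T} => [tuple X i | i < m]) => [t _|X _].
  by apply: eq_from_tnth => i; rewrite tnth_mktuple ffunE.
by apply/ffunP => i; rewrite ffunE tnth_mktuple.
Qed.

End Transfer.

(** * Choice of the parameters *)

Section ParameterChoice.
Context (R : realType).
Implicit Types (x rho eps kap M : R).

Lemma nat_above x : 0 <= x -> exists2 N : nat, (0 < N)%N & x <= N%:R <= x + 1.
Proof.
move=> x0; exists (Num.truncn x).+1 => //.
have /andP[h1 h2] := truncn_itv x0.
by rewrite (ltW h2) -natr1 lerD2r.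
Qed.

Lemma powR_pow (a b : R) (i j : nat) : 0 <= a -> b * i%:R = j%:R ->
  (a `^ b) ^+ i = a ^+ j.
Proof. by move=> a0 bij; rewrite -!powR_mulrn ?powR_ge0 // -powRrM bij. Qed.

Definition sample_bound (n : nat) rho eps : R :=
  n%:R `^ (2 / 3) / (eps `^ (4 / 3) * rho `^ (2 / 3))
  + Num.sqrt n%:R / (eps ^+ 2 * rho) + 1 / (eps ^+ 2 * rho ^+ 2).

(** Each summand is at most [y / M]; cubing the first and squaring the second removes the fractional
    powers, and [M <= M ^+ j.+1] keeps one factor [M]. *)
Lemma sample_boundP (n : nat) rho eps M y : 0 < rho -> 0 < eps -> 1 <= M ->
  M * sample_bound n rho eps <= y ->
  [/\ M * n%:R ^+ 2 <= rho ^+ 2 * eps ^+ 4 * y ^+ 3,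
      M * n%:R <= rho ^+ 2 * eps ^+ 4 * y ^+ 2,
      M <= rho ^+ 2 * eps ^+ 2 * y
    & 1 / (eps ^+ 2 * rho ^+ 2) <= sample_bound n rho eps].
Proof.
move=> r0 e0 M1; rewrite /sample_bound.
set d1 := _ * rho `^ _; set a := _ / d1.
set c := Num.sqrt _ / _; set e := 1 / _ => My.
have d10 : 0 < d1 by rewrite mulr_gt0 ?powR_gt0.
have M0 : 0 < M by apply: lt_le_trans M1.
have a0 : 0 <= a by rewrite divr_ge0 ?powR_ge0 // ltW.
have c0 : 0 <= c by rewrite divr_ge0 ?sqrtr_ge0 // mulr_ge0 ?exprn_ge0 // ltW.
have e0' : 0 <= e by rewrite divr_ge0 // mulr_ge0 ?exprn_ge0 // ltW.
have Ma : 0 <= M * a by rewrite mulr_ge0 // ltW.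
have Mc : 0 <= M * c by rewrite mulr_ge0 // ltW.
have Me : 0 <= M * e by rewrite mulr_ge0 // ltW.
have [ya yc ye] : [/\ M * a <= y, M * c <= y & M * e <= y] by split; lra.
have MM j : M <= M ^+ j.+1 by rewrite exprS ler_peMr ?(ltW M0) // exprn_ege1.
split; last by lra.
- have d13 : d1 ^+ 3 = rho ^+ 2 * eps ^+ 4.
    rewrite /d1 exprMn mulrC (@powR_pow rho _ 3 2) ?(ltW r0) //; last by lra.
    by rewrite (@powR_pow eps _ 3 4) ?(ltW e0) //; lra.
  have -> : n%:R ^+ 2 = (rho ^+ 2 * eps ^+ 4) * a ^+ 3.
    rewrite -d13 /a expr_div_n (@powR_pow n%:R _ 3 2) //; last by lra.
    by rewrite mulrCA mulfV ?mulr1 // expf_neq0 // gt_eqF.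
  rewrite mulrCA ler_pM2l; last by rewrite mulr_gt0 ?exprn_gt0.
  apply: (@le_trans _ _ ((M * a) ^+ 3)).
    by rewrite (exprMn _ M a) ler_wpM2r ?exprn_ge0 ?MM.
  by apply: lerXn2r; rewrite ?nnegrE // (le_trans Ma).
- have -> : n%:R = (rho ^+ 2 * eps ^+ 4) * c ^+ 2.
    rewrite /c expr_div_n sqr_sqrtr //; field.
    by rewrite !gt_eqF.
  rewrite mulrCA ler_pM2l; last by rewrite mulr_gt0 ?exprn_gt0.
  apply: (@le_trans _ _ ((M * c) ^+ 2)).
    by rewrite (exprMn _ M c) ler_wpM2r ?exprn_ge0 ?MM.
  by apply: lerXn2r; rewrite ?nnegrE // (le_trans Mc).
- have -> : M = (rho ^+ 2 * eps ^+ 2) * (M * e).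
    by rewrite /e; field; rewrite !gt_eqF.
  by rewrite ler_pM2l // mulr_gt0 ?exprn_gt0.
Qed.

(** According to which of [n] and [k] is larger, [n + 2 * k] is at most three times it, and the
    minimum is at most [n] or [2 * k]; the worst constant is 2 * 25 * 9 = 450. *)
Lemma separation_bounds (n k : nat) rho eps kap :
  (0 < k)%N -> 0 < rho -> 0 < eps -> eps <= 2 -> 0 < kap ->
  450 * n%:R ^+ 2 <= kap * (rho ^+ 2 * eps ^+ 4 * k%:R ^+ 3) ->
  450 * n%:R <= kap * (rho ^+ 2 * eps ^+ 4 * k%:R ^+ 2) ->
  450 <= kap * (rho ^+ 2 * eps ^+ 2 * k%:R) ->
  let theta := eps ^+ 2 / (5 * (n + 2 * k)%:R) in
  Num.min n%:R (2 * k%:R) / k%:R ^+ 2 <= kap * (rho * (k%:R * theta)) ^+ 2 /\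
  1 <= kap * (rho * k%:R) ^+ 2 * theta.
Proof.
move=> k0 r0 e0 e2 kap0 h1 h2 h3 /=.
have y0 : 0 < k%:R :> R by rewrite ltr0n.
rewrite natrD natrM; set y : R := k%:R in y0 h1 h2 h3 *; set x : R := n%:R in h1 h2 *.
have x0 : 0 <= x by [].
have W0 : 0 < x + 2 * y by lra.
have y2 : 0 < y ^+ 2 by rewrite exprn_gt0.
have W2 : 0 < (x + 2 * y) ^+ 2 by rewrite exprn_gt0.
split.
  have -> : kap * (rho * (y * (eps ^+ 2 / (5 * (x + 2 * y))))) ^+ 2 =
    kap * (rho ^+ 2 * eps ^+ 4 * y ^+ 2) / (25 * (x + 2 * y) ^+ 2).
    by field; rewrite gt_eqF.
  rewrite ler_pdivrMr // mulrAC ler_pdivlMr ?mulr_gt0 //.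
  have [xy|yx] := leP x y.
    apply: (@le_trans _ _ (x * (25 * (9 * y ^+ 2)))).
      apply: ler_pM; rewrite ?le_min ?x0 ?mulr_ge0 ?exprn_ge0 ?ge_min ?lexx //; try lra.
      rewrite ler_wpM2l // -[9]/((3 * 3)%:R) natrM.
      have -> : 3 * 3 * y ^+ 2 = (3 * y) ^+ 2 by ring.
      by apply: lerXn2r; rewrite ?nnegrE; lra.
    have := ler_wpM2r (ltW y2) h2.
    have : 0 <= x * y ^+ 2 by rewrite mulr_ge0 // ltW.
    lra.
  apply: (@le_trans _ _ (2 * y * (25 * (9 * x ^+ 2)))).
    apply: ler_pM; rewrite ?le_min ?x0 ?mulr_ge0 ?exprn_ge0 ?ge_min ?lexx ?orbT //; try lra.
    rewrite ler_wpM2l // -[9]/((3 * 3)%:R) natrM.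
    have -> : 3 * 3 * x ^+ 2 = (3 * x) ^+ 2 by ring.
    by apply: lerXn2r; rewrite ?nnegrE; lra.
  have := ler_wpM2r (ltW y0) h1; lra.
rewrite mulrA ler_pdivlMr ?mulr_gt0 // mul1r.
have e4 : eps ^+ 2 <= 4.
  have -> : 4 = 2 ^+ 2 :> R by ring.
  by apply: lerXn2r; rewrite ?nnegrE // ltW.
have q0 : 0 <= kap * (rho ^+ 2 * eps ^+ 2 * y ^+ 2).
  by rewrite !mulr_ge0 ?exprn_ge0 // ltW.
have := ler_wpM2l q0 e4; have := ler_wpM2r (ltW y0) h3; lra.
Qed.

Definition kappa0 : R := 128^-1 * 100^-1.
(** With this value [4 * L ^+ 2 * kappa] is the square of [kappa0 * L], so that the vote condition
    follows from the one on [spread] once [m0 >= L * rho * k]. *)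
Definition kappa : R := (kappa0 / 2) ^+ 2.

(** The choice is [L = 2 * r * l] with [l] about [20 / sqrt rho]: already
    [2 ^- l <= 1 / l <= sqrt rho / 20]. Boundedness of [L ^+ 2 * rho] keeps the cost of the votes
    within a constant times [k]; the last bound absorbs rounding. *)
Lemma repetitions_choice (r : nat) rho : (0 < r)%N -> 0 < rho -> rho <= 1 ->
  exists2 L : nat, (0 < L)%N & [/\ 2 * 2^-1 ^+ L <= rho ^+ r / 10,
    L%:R ^+ 2 * rho <= 1764 * r%:R ^+ 2 & L%:R <= 42 * r%:R / rho ^+ 2].
Proof.
move=> r_gt0 r0 r1.
pose sg := Num.sqrt rho.
have sg0 : 0 < sg by rewrite sqrtr_gt0.
have sg2 : sg ^+ 2 = rho by rewrite sqr_sqrtr // ltW.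
have sg1 : sg <= 1 by rewrite -(sqrtr1 R) ler_wsqrtr.
have [l l0 /andP[l1 l2]] := nat_above (divr_ge0 (ler0n R 20) (ltW sg0)).
have lR : 0 < l%:R :> R by rewrite ltr0n.
have ls : 20 <= l%:R * sg by rewrite -ler_pdivrMr.
have sl : l%:R * sg <= 21.
  have := ler_wpM2r (ltW sg0) l2; rewrite mulrDl divfK ?gt_eqF //; lra.
have rR : 0 < r%:R :> R by rewrite ltr0n.
exists (2 * r * l)%N; first by rewrite !muln_gt0 r_gt0.
have lsr : 0 <= l%:R * sg by rewrite mulr_ge0 // ltW.
split.
- have : 2^-1 ^+ l <= sg / 20 :> R.
    apply: (@le_trans _ _ l%:R^-1).
      rewrite exprVn lef_pV2 ?posrE ?exprn_gt0 // -natrX ler_nat ltnW //.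
      exact: ltn_expl.
    by rewrite -(ler_pM2l lR) mulfV ?gt_eqF // mulrA ler_pdivlMr // mul1r.
  move=> h; have p0 : 0 <= 2^-1 ^+ l :> R by rewrite exprn_ge0 ?invr_ge0.
  have [z [z0 zE z20]] : exists z : R, [/\ 0 <= z, rho * z = (sg / 20) ^+ 2 & 20 * z <= 1].
    by exists (20^-1 ^+ 2); split; [rewrite sqr_ge0|rewrite exprMn sg2|lra].
  have h2 : (2^-1 ^+ l) ^+ 2 <= rho * z :> R.
    rewrite zE; apply: lerXn2r h; rewrite nnegrE //.
    by rewrite divr_ge0 // (ltW sg0).
  have h3 : 2^-1 ^+ (2 * r * l) <= rho ^+ r * z ^+ r :> R.
    have -> : 2^-1 ^+ (2 * r * l) = ((2^-1 ^+ l) ^+ 2) ^+ r :> R.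
      by rewrite -2!exprM mulnC.
    rewrite -exprMn; apply: lerXn2r h2; rewrite nnegrE.
      by rewrite exprn_ge0.
    by rewrite mulr_ge0 // (ltW r0).
  have h4 : z ^+ r <= z.
    rewrite -(prednK r_gt0) exprS ler_piMr // exprn_ile1 //; lra.
  have h5 : 0 <= rho ^+ r by rewrite exprn_ge0 // (ltW r0).
  have h6 := ler_wpM2l h5 h4; have h7 := ler_wpM2l h5 z20.
  by clear -h3 h6 h7; lra.
- rewrite !natrM -sg2.
  have -> : (2 * r%:R * l%:R) ^+ 2 * sg ^+ 2 = 4 * r%:R ^+ 2 * (l%:R * sg) ^+ 2 by ring.
  have h : (l%:R * sg) ^+ 2 <= 21 ^+ 2 by apply: lerXn2r; rewrite ?nnegrE.
  have r2 : 0 <= 4 * r%:R ^+ 2 :> R by rewrite mulr_ge0 ?exprn_ge0.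
  have := ler_wpM2l r2 h; lra.
- rewrite !natrM ler_pdivlMr ?exprn_gt0 //.
  have sg4 : rho ^+ 2 <= sg.
    rewrite -sg2 -exprM -[leRHS]expr1; apply: ler_wiXn2l => //; exact: ltW.
  have c0 : 0 <= 2 * r%:R * l%:R :> R by rewrite !mulr_ge0.
  have := ler_wpM2l c0 sg4.
  have r2 : 0 <= 2 * r%:R :> R by rewrite mulr_ge0.
  have := ler_wpM2l r2 sl; lra.
Qed.

Lemma parameter_choice (r : nat) : (0 < r)%N ->
  exists2 K : R, 0 < K & forall (n : nat) rho eps,
    0 < rho -> rho <= 1 -> 0 < eps -> eps <= 2 ->
  exists b L m0 : nat,
    let k := (L * b)%N in
    let theta := eps ^+ 2 / (5 * (n + 2 * k)%:R) in
    let spread := Num.min n%:R (2 * k%:R) / k%:R ^+ 2 in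
    [/\ [/\ (0 < b)%N, (0 < L)%N & (0 < m0)%N],
        2 * 2^-1 ^+ L <= rho ^+ r / 10,
        [/\ 4 * L%:R ^+ 2 * spread <= (kappa0 * (m0%:R * theta)) ^+ 2,
            spread <= kappa * (rho * (k%:R * theta)) ^+ 2
          & 1 <= kappa * (rho * k%:R) ^+ 2 * theta]
      & (k + (k + (k + L * (m0 + m0))))%:R <= K * sample_bound n rho eps].
Proof.
move=> r_gt0; pose M : R := 450 / kappa.
have kap0 : 0 < kappa0 by rewrite mulr_gt0 ?invr_gt0.
have kap : 0 < kappa by rewrite exprn_gt0 // divr_gt0.
have M0 : 0 < M by apply: divr_gt0 kap; rewrite ltr0n.
have M1 : 1 <= M by rewrite ler_pdivlMr // mul1r /kappa /kappa0; lra.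
have rR : 0 < r%:R :> R by rewrite ltr0n.
(* With [m0 <= L * rho * k + 1] the total [3 * k + 2 * L * m0] is at most
   [(3 + 3528 * r ^+ 2) * k + 2 * L]. Then [k] is at most [M + 168 * r] and [L] at most [168 * r]
   times the sample bound. *)
pose K : R := (3 + 3528 * r%:R ^+ 2) * (M + 168 * r%:R) + 336 * r%:R.
have rr2 : 0 <= r%:R ^+ 2 :> R by rewrite exprn_ge0.
have c1 : 0 < 3 + 3528 * r%:R ^+ 2 :> R by clear -rr2; lra.
have c2 : 0 < M + 168 * r%:R by clear -M0 rR; lra.
exists K.
  by have := mulr_gt0 c1 c2; rewrite /K; clear -rR; lra.
move=> n rho eps r0 r1 e0 e2.
have [L L0 [Ldelta Lrho Lsmall]] := repetitions_choice r_gt0 r0 r1.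
set H := sample_bound n rho eps.
have [_ _ _ Hge] := sample_boundP (n := n) r0 e0 M1 (lexx _).
rewrite -/H in Hge.
have er0 : 0 < eps ^+ 2 * rho ^+ 2 by rewrite mulr_gt0 ?exprn_gt0.
have H0 : 0 < H by apply: lt_le_trans Hge; rewrite divr_gt0.
have LR : 0 < L%:R :> R by rewrite ltr0n.
have LH : L%:R <= 168 * r%:R * H.
  apply: le_trans Lsmall _; rewrite ler_pdivrMr ?exprn_gt0 //.
  have e4 : eps ^+ 2 <= 4.
    have -> : 4 = 2 ^+ 2 :> R by ring.
    by apply: lerXn2r; rewrite ?nnegrE // ltW.
  have r2 : 0 < rho ^+ 2 by rewrite exprn_gt0.
  have h : 1 <= 4 * (H * rho ^+ 2).
    move: Hge; rewrite ler_pdivrMr // => h1; apply: le_trans h1 _.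
    rewrite [leLHS]mulrCA ler_wpM2r //; first by rewrite mulr_ge0 // ltW.
  have := ler_wpM2l (mulr_ge0 (ler0n R 42) (ltW rR)) h; clear; lra.
have [b b0 /andP[b1 b2]] := nat_above (divr_ge0 (ltW (mulr_gt0 M0 H0)) (ltW LR)).
set k := (L * b)%N.
have k0 : (0 < k)%N by rewrite muln_gt0 L0.
have kge : M * H <= k%:R by rewrite natrM (mulrC L%:R) -ler_pdivrMr.
have kle : k%:R <= M * H + L%:R.
  have := ler_wpM2l (ltW LR) b2; rewrite mulrDr mulr1 mulrCA mulfV ?gt_eqF // mulr1.
  by rewrite natrM.
have kR : 0 < k%:R :> R by rewrite ltr0n.
have x0 : 0 <= L%:R * rho * k%:R by rewrite !mulr_ge0 // ltW.
have [m0 m00 /andP[m1 m2]] := nat_above x0.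
exists b, L, m0 => /=; rewrite -/k.
have [f1 f2 f3 _] := sample_boundP r0 e0 M1 kge.
have kM : kappa * M = 450 by rewrite /M mulrC divfK ?gt_eqF.
have g1 := ler_wpM2l (ltW kap) f1; rewrite mulrA kM in g1.
have g2 := ler_wpM2l (ltW kap) f2; rewrite mulrA kM in g2.
have g3 := ler_wpM2l (ltW kap) f3; rewrite kM in g3.
have [s1 s2] := separation_bounds k0 r0 e0 e2 kap g1 g2 g3.
split => //.
  split => //.
  set theta := _ / (5 * _) in s1 s2 *.
  have th0 : 0 < theta.
    by rewrite divr_gt0 ?exprn_gt0 // mulr_gt0 // ltr0n addn_gt0 muln_gt0 k0 orbT.
  have L2 : 0 <= 4 * L%:R ^+ 2 :> R by rewrite mulr_ge0 ?exprn_ge0.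
  apply: le_trans (ler_wpM2l L2 s1) _.
  have -> : 4 * L%:R ^+ 2 * (kappa * (rho * (k%:R * theta)) ^+ 2) =
     (kappa0 * (L%:R * rho * k%:R * theta)) ^+ 2 by rewrite /kappa; field.
  have t0 := ltW th0; have q0 := ltW kap0.
  apply: lerXn2r; rewrite ?nnegrE.
  - by rewrite mulr_ge0 // mulr_ge0.
  - by rewrite mulr_ge0 // mulr_ge0.
  - by rewrite ler_wpM2l // ler_wpM2r.
rewrite !natrD (natrM _ L) natrD.
have h1 := ler_wpM2l (ltW LR) m2.
have h2 := ler_wpM2r (ltW kR) Lrho.
have h3 : k%:R <= (M + 168 * r%:R) * H by clear -kle LH; lra.
have h4 := ler_wpM2l (ltW c1) h3.
rewrite /K; clear -h1 h2 h4 LH; lra.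
Qed.

End ParameterChoice.

(** * The tester *)

Section ProductLaw.
Context (R : realType) (n : nat) (p q : 'I_n -> R).
Context (hp : is_distribution p) (hq : is_distribution q).
Local Notation T := ('I_n * 'I_n)%type.

Let pq_ge0 (x : T) : 0 <= p x.1 * q x.2.
Proof. by rewrite mulr_ge0 ?hp.1 ?hq.1. Qed.

Let pq_sum (f : T -> R) :
  \sum_x p x.1 * q x.2 * f x = \sum_i p i * \sum_j q j * f (i, j).
Proof.
transitivity (\sum_i \sum_j p i * q j * f (i, j)).
  by rewrite pair_bigA; apply: eq_bigr => -[i j] _.
by apply: eq_bigr => i _; rewrite mulr_sumr; apply: eq_bigr => j _; rewrite mulrA.
Qed.

Let pq_sum1 : \sum_(x : T) p x.1 * q x.2 = 1.
Proof.
have := pq_sum (fun=> 1); under eq_bigr do rewrite mulr1.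
move=> ->; under eq_bigr do under eq_bigr do rewrite mulr1.
by under eq_bigr do rewrite hq.2 mulr1; rewrite hp.2.
Qed.

Definition product_law : law R T := Law pq_ge0 pq_sum1.

Lemma bias_product_law i : bias product_law i = p i - q i.
Proof.
rewrite /bias /mean /= pq_sum /diff /=.
have pick (r : 'I_n -> R) : \sum_j r j * (j == i)%:R = r i.
  rewrite (bigD1 i) //= eqxx mulr1 big1 ?addr0 // => j ji.
  by rewrite (negbTE ji) mulr0.
under eq_bigr => j _.
  under eq_bigr do rewrite mulrBr.
  rewrite sumrB pick -mulr_suml hq.2 mul1r mulrBr.
  over.
by rewrite sumrB pick -mulr_suml hp.2 mul1r.
Qed.

Lemma domain_gt0 : (0 < n)%N.
Proof.
case: (posnP n) => // n0; have := hp.2; rewrite big1.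
  by move/eqP; rewrite eq_sym oner_eq0.
by case=> i lt_in; exfalso; move: lt_in; rewrite n0.
Qed.

Section StatisticTester.
Context (N : nat) (stat : seq T -> R).

Definition stat_tester : tester R n N :=
  threshold_tester (fun X : samples n N => stat (codom X)).

Lemma sample_prob_ge0 (X : samples n N) : 0 <= sample_prob p q X.
Proof. by apply: prodr_ge0 => i _; exact: pq_ge0. Qed.

Lemma expect_samples (F : seq T -> R) :
  \sum_(X : samples n N) sample_prob p q X * F (codom X) = expect product_law N F.
Proof. exact: expect_ffun product_law N F. Qed.

Lemma output_accept :
  expect product_law N (fun s => (stat s <= 2)%R%:R) <=
  output_prob stat_tester p q true.
Proof.
rewrite -expect_samples; apply: ler_sum => X _.
apply: ler_wpM2l; first exact: sample_prob_ge0.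
case: (leP (stat (codom X)) 2) => [le2|_]; last by rewrite fine_ge0 ?measure_ge0.
rewrite /= threshold_law1 // => r /=; rewrite in_itv /= => /andP[r2 _].
exact: le_trans r2.
Qed.

Lemma output_reject :
  expect product_law N (fun s => (3 < stat s)%R%:R) <=
  output_prob stat_tester p q false.
Proof.
rewrite -expect_samples; apply: ler_sum => X _.
apply: ler_wpM2l; first exact: sample_prob_ge0.
case: (ltP 3 (stat (codom X))) => [gt3|_]; last by rewrite fine_ge0 ?measure_ge0.
rewrite /= threshold_law1 // => r /=; rewrite in_itv /= => /andP[_ r3].
by apply/negbTE; rewrite -ltNge; exact: le_lt_trans gt3.
Qed.

(** The triangle inequality through the fixed point [t] reduces a pair of runs to one run, counted
    twice. *)
Lemma agreement_bound (t : R) :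
  1 - 2 * expect product_law N (fun s => `|clip (stat s) - clip t|) <=
  agreement_prob stat_tester p q.
Proof.
pose e s := `|clip (stat s) - clip t|; set E := expect _ _ _.
apply: (@le_trans _ _ (\sum_(X : samples n N) sample_prob p q X *
    \sum_(X' : samples n N) sample_prob p q X' * (1 - e (codom X) - e (codom X')))).
  rewrite (eq_bigr (fun X : samples n N => sample_prob p q X *
      ((fun s => 1 - e s - E) (codom X)))); last first.
    move=> X _; rewrite (expect_samples (fun s => 1 - e (codom X) - e s)).
    by rewrite expectB expect_cst.
  rewrite (expect_samples (fun s => 1 - e s - E)) expectB expectB !expect_cst -/E.
  by rewrite -/e; lra.
apply: ler_sum => X _; rewrite mulr_sumr; apply: ler_sum => X' _.
rewrite mulrA; apply: ler_wpM2l; first by rewrite mulr_ge0 ?sample_prob_ge0.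
apply: le_trans (threshold_law_agree (stat (codom X)) (stat (codom X'))).
have := ler_distD (clip t) (clip (stat (codom X))) (clip (stat (codom X'))).
rewrite /e (distrC (clip (stat (codom X')))); lra.
Qed.

End StatisticTester.
End ProductLaw.

Definition split_stat (R : realType) n (theta : R) (k L m0 : nat)
    (s : seq ('I_n * 'I_n)) : R :=
  decision_stat theta k L m0 (take k s) (take k (drop k s))
    (take k (drop k (drop k s))) (drop k (drop k (drop k s))).

Lemma expect_split_stat (R : realType) n (P : law R ('I_n * 'I_n)%type) (theta : R)
    k L m0 (G : R -> R) :
  expect P (k + (k + (k + L * (m0 + m0)))) (fun s => G (split_stat theta k L m0 s)) =
  expect P k (fun F => expect P k (fun A => expect P k (fun B =>
    expect P (L * (m0 + m0)) (fun V => G (decision_stat theta k L m0 F A B V))))).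
Proof.
rewrite expect_cat; apply: eq_expect => F Fk.
rewrite expect_cat; apply: eq_expect => A Ak.
rewrite expect_cat; apply: eq_expect => B Bk; apply: eq_expect => V _.
rewrite /split_stat; congr (G (decision_stat _ _ _ _ _ _ _ _)).
- by rewrite take_size_cat.
- by rewrite drop_size_cat // take_size_cat.
- by rewrite !drop_size_cat // take_size_cat.
- by rewrite !drop_size_cat.
Qed.

Theorem mainTheorem6 (R : realType) (C : R) :
  exists2 K : R, 0 < K &
    forall (n : nat) (rho eps : R), 0 < rho -> rho <= 1 -> 0 < eps ->
      exists (m : nat) (A : tester R n m),
        solves_replicable_closeness eps rho (rho `^ C) A /\
        m%:R <= K * (n%:R `^ (2 / 3) / (eps `^ (4 / 3) * rho `^ (2 / 3))
                     + Num.sqrt n%:R / (eps ^+ 2 * rho)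
                     + 1 / (eps ^+ 2 * rho ^+ 2)).
Proof.
(* An integer exponent above [C], whatever its sign, and at least 1: [rho ^+ r] is below both the
   error bound and [rho]. *)
pose r := (Num.truncn `|C|).+1.
have [K K0 hK] := @parameter_choice R r isT.
exists K => // n rho eps r0 r1 e0.
(* The distance never exceeds 2, so for larger [eps] nothing has to be rejected: a constant
   statistic with no samples always accepts. *)
have [e2|e2] := leP eps 2; last first.
  exists 0, (stat_tester (n := n) 0 (fun=> 0)); split.
    have rC : 0 <= rho `^ C by exact: powR_ge0.
    split=> p q hp hq.
    - move=> _; apply: le_trans (output_accept hp hq 0 (fun=> 0)).
      by rewrite expect_cst (_ : (0 <= 2)%R) //=; lra.
    - move=> far; exfalso; move: far; apply/negP; rewrite -ltNge.
      apply: le_lt_trans e2; rewrite /l1_distance.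
      apply: (@le_trans _ _ (\sum_(i < n) (p i + q i))).
        apply: ler_sum => i _; apply: le_trans (ler_normB _ _) _.
        by rewrite !ger0_norm ?hp.1 ?hq.1.
      by rewrite big_split /= hp.2 hq.2; lra.
    - apply: le_trans (agreement_bound hp hq 0 (fun=> 0) 0).
      by rewrite expect_cst subrr normr0; lra.
  rewrite mulr_ge0 ?(ltW K0) // !addr_ge0 ?divr_ge0 ?mulr_ge0 ?powR_ge0 ?sqrtr_ge0
    ?exprn_ge0 ?(ltW r0) ?(ltW e0) //.
have [b [L [m0 []]]] := hK n rho eps r0 r1 e0 e2.
set k := (L * b)%N; set theta := _ / (5 * _) => -[b0 L0 m00] small [v1 v2 v3] size_le.
exists (k + (k + (k + L * (m0 + m0))))%N, (stat_tester (n := n) _ (split_stat theta k L m0)).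
split=> //.
have k0 : (0 < k)%N by rewrite muln_gt0 L0.
have th0 : 0 < theta.
  by rewrite divr_gt0 ?exprn_gt0 // mulr_gt0 // ltr0n addn_gt0 muln_gt0 k0 orbT.
have kap00 : 0 < kappa0 R by rewrite mulr_gt0 ?invr_gt0.
have kap01 : 128 * (100 * kappa0 R) <= 1 by rewrite /kappa0; lra.
have kap1 : 1000 * (1000 * kappa R) <= 1 by rewrite /kappa /kappa0; lra.
have rho_r : rho ^+ r <= rho.
  by rewrite exprS ler_piMr ?(ltW r0) // exprn_ile1 // ltW.
have rho_C : rho ^+ r <= rho `^ C.
  rewrite -powR_mulrn ?(ltW r0) // ger_powR ?r0 // /r.
  apply: le_trans (ler_norm C) _.
  by have /andP[_ /ltW] := truncn_itv (normr_ge0 C).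
have bad_small (p q : 'I_n -> R) (hp : is_distribution p) (hq : is_distribution q) :
  expect (product_law hp hq) k (fun F => expect (product_law hp hq) (L * (m0 + m0))
    (fun V => (bad (product_law hp hq) theta b L m0 F V)%:R)) <= rho `^ C.
  have n0 := domain_gt0 hp.
  apply: le_trans (bad_prob (product_law hp hq) n0 b0 L0 m00 th0 kap00 kap01 v1) _.
  apply: le_trans small _; have : 0 <= rho ^+ r by rewrite exprn_ge0 // ltW.
  lra.
split=> p q hp hq.
- move=> pq; apply: le_trans (output_accept hp hq _ _).
  rewrite (expect_split_stat _ _ _ _ _ (fun z => (z <= 2)%R%:R)).
  apply: le_trans (lerB (lexx 1) (bad_small _ _ hp hq)) _.
  rewrite -[X in X - _](expect_cst (product_law hp hq) k) -expectB.
  apply: ler_expect => F Fk.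
  rewrite -[leLHS](expect_cst (product_law hp hq) k); apply: ler_expect => A _.
  rewrite -[leLHS](expect_cst (product_law hp hq) k); apply: ler_expect => B _.
  rewrite -[X in X - _](expect_cst (product_law hp hq) (L * (m0 + m0))) -expectB.
  apply: ler_expect => V _.
  have := @decision_stat_null R n (product_law hp hq) theta b L m0 F A B V.
  case: (bad _ _ _ _ _ _ _) => [_|->]; rewrite ?subrr ?subr0 ?ler0n //=.
  rewrite /scaled_mean /zmean big1 ?mul0r // => i _.
  by rewrite bias_product_law pq subrr expr0n mulr0.
- move=> far; apply: le_trans (output_reject hp hq _ _).
  rewrite (expect_split_stat _ _ _ _ _ (fun z => (3 < z)%R%:R)).
  apply: le_trans (lerB (lexx 1) (bad_small _ _ hp hq)) _.
  rewrite -[X in X - _](expect_cst (product_law hp hq) k) -expectB.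
  apply: ler_expect => F Fk.
  rewrite -[leLHS](expect_cst (product_law hp hq) k); apply: ler_expect => A _.
  rewrite -[leLHS](expect_cst (product_law hp hq) k); apply: ler_expect => B _.
  rewrite -[X in X - _](expect_cst (product_law hp hq) (L * (m0 + m0))) -expectB.
  apply: ler_expect => V _.
  have := @decision_stat_far R n (product_law hp hq) theta b L m0 F A B V.
  case: (bad _ _ _ _ _ _ _) => [_|->]; rewrite ?subrr ?subr0 ?ltr_nat //=.
  (* The factor 5 in [theta] is chosen so that this lower bound puts the scaled mean at 5 or
     more. *)
  have := zmean_ge (product_law hp hq) F (domain_gt0 hp); rewrite Fk.
  rewrite /scaled_mean ler_pdivlMr //.
  under eq_bigr do rewrite bias_product_law.
  rewrite -/(l1_distance p q); apply: le_trans.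
  have W0 : 0 < (n + 2 * k)%:R :> R by rewrite ltr0n addn_gt0 muln_gt0 k0 orbT.
  rewrite ler_pdivlMr // /theta.
  have -> : 5 * (eps ^+ 2 / (5 * (n + 2 * k)%:R)) * (n + 2 * k)%:R = eps ^+ 2.
    by move: W0; move: ((n + 2 * k)%:R : R) => W W0; field; rewrite gt_eqF.
  by apply: lerXn2r; rewrite ?nnegrE ?(ltW e0) // (le_trans (ltW e0)).
- have n0 := domain_gt0 hp.
  (* Two runs lose at most 2 * (rho/10 + rho^r/10), which is below [rho]. *)
  apply: le_trans (agreement_bound hp hq _ _ (target (product_law hp hq) theta b L)).
  rewrite (expect_split_stat _ _ _ _ _
    (fun z => `|clip z - clip (target (product_law hp hq) theta b L)|)).
  have := clip_decision_stat_expect (product_law hp hq) n0 b0 L0 m00 th0 r0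
    kap00 kap01 kap1 v1 v2 v3.
  have : 0 <= rho ^+ r by rewrite exprn_ge0 // ltW.
  lra.
Qed.
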